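(* Let $T\subset\ell^2$ be finite with $|T|\ge2$, let $\sigma$ be a large enough integer (fixed depending on $r$), and let $\{f_{n,j}\}_{n\in\mathbb{N},j\in\mathbb{Z}}$ be the family of functions on $T$ produced by the recursive greedy construction described in the context. Then $$\gamma(T)\lesssim_r\Bigl(\sup_{u\in T,\,n,\,j}f_{n,j}(u)+r^{-j_0(T)}\Bigr).$$
   Context: **Process and balls.** $(Y_i)_{i\ge1}$ are independent symmetric random variables; $U_i(x)=-\log\mathsf{P}\{|Y_i|\ge x\}$ is convex with $U_i(0)=0$, $U_i(1)=1$, and for a fixed constant $C_0$: $U_i(2s)\le C_0U_i(s)$ for all $i$ and $s\ge1$, and $U_i'(0)\ge1/C_0$ for all $i$ (right derivative). $\hat U_i(x)=x^2$ for $|x|\le1$, $\hat U_i(x)=2U_i(|x|)-1$ for $|x|\ge1$; $\mathcal{N}_u(t)=\sup\{\sum_it_ia_i:\sum_i\hat U_i(a_i)\le u\}$; $B(u)=\{t\in\ell^2:\mathcal{N}_u(t)\le u\}$ for $u>0$. $r=2^{\kappa-3}$, where $\kappa\ge5$ is an integer large enough that $B(8ru)\subset\rho rB(u)$ for all $u>0$ with some $\rho<\frac1{10}$. $\varphi_j(s,t)=\inf\{u>0:s-t\in r^{-j}B(u)\}$; $B_j(s,c)=\{t\in T:\varphi_j(s,t)\le c\}$; $4B_j(s,c)$ as a ball centred at $s$ means $\{t\in T:\varphi_j(s/4,t/4)\le c\}$. $N_0=1$, $N_n=2^{2^n}$ for $n\ge1$; $r^{-\infty}=0$. $A\lesssim_rB$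 means $A\le C(r)B$ with $C(r)$ depending only on $r$ ($C_0$ being fixed). **The functional $\gamma$.** For $A\subset T$, $j_n(A)=\sup\{j\in\mathbb{Z}:\varphi_j(x,y)\le2^n\ \forall x,y\in A\}$; $j_0=j_0(T)$. An admissible sequence is an increasing (successively refining) sequence $(\mathcal{A}_n)_{n\ge0}$ of partitions of $T$ with $|\mathcal{A}_n|\le N_n$; $A_n(t)$ is the element of $\mathcal{A}_n$ containing $t$. $\gamma(T)=\inf_{(\mathcal{A}_n)}\sup_{t\in T}\sum_{n\ge0}2^nr^{-j_n(A_n(t))}$. **Construction of $f_{n,j}$.** $n(T)$ is the smallest integer with $|T|\le N_{n(T)}$; $j(T)$ is the smallest integer with $\varphi_{j(T)}(x,x')>2^{n(T)}$ for all distinct $x,x'\in T$. (i) $f_{n,j}=0$ if $n>n(T)+\kappa$ and $j>j_0-\sigma-3$, or if $n\ge0$ and $j\ge j(T)+\sigma+3$. (ii) For the remaining $(n,j)$ with $0\le n\le n(T)+\kappa$ and $j_0-\sigma-2\le j\le j(T)+\sigma+3$, $f_{n,j}$ is defined recursively once $f_{n+z,j+z'}$ is defined for all $z,z'\in\mathbb{N}$, $z+z'\ne0$. For $u\in T$, define $A_{n,j}(u)$ greedily: choose $x_1\in B_{j+1}(u,2^n)$ maximizing $f_{n+\kappa,j+\sigma+3}$ over $B_{j+1}(u,2^n)$. For $1\le m<N_{n+\kappa}$, when $x_1,\dots,x_m$ are chosen: if $B_{j+1}(u,2^n)\setminus\bigcup_{i\le m}4B_{j+\sigma+3}(x_i,2^{n+\kappa})=\varnothing$,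 stop and set $A_{n,j}(u)=0$; otherwise let $x_{m+1}$ maximize $f_{n+\kappa,j+\sigma+3}$ over this set. If $x_1,\dots,x_{N_{n+\kappa}}$ are all obtained, set $A_{n,j}(u)=2^nr^{-j-\sigma-1}+f_{n+\kappa,j+\sigma+3}(x_{N_{n+\kappa}})$. Then $$f_{n,j}(u)=\max\{f_{n+\kappa,j+1}(u),\,A_{n,j}(u),\,f_{n,j+1}(u)\}.$$ (iii) For $n\ge0$ and $j\le j_0-\sigma-3$: $f_{n,j}=\sup\{f_{m,l}:m\ge0,\ l\ge j_0-\sigma-2\}$ (pointwise on $T$). *)

(* Defs.v *)
From HB Require Import structures.
From mathcomp Require Import all_boot all_order all_algebra.
From mathcomp Require Import finmap.
From mathcomp Require Import all_classical all_reals all_analysis.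

Set Implicit Arguments.
Unset Strict Implicit.
Unset Printing Implicit Defensive.

Import Order.TTheory GRing.Theory Num.Theory.
Import numFieldNormedType.Exports.

Local Open Scope ring_scope.

(* Sequences indexed by i >= 1 are indexed here by nat, starting at 0. *)

Section Process.
Context {d : measure_display} {Omega : measurableType d} {R : realType}.
Variables (P : probability Omega R) (Y : nat -> {RV P >-> R}).

Definition independent : Prop :=
  forall (J : {fset nat}) (E : nat -> set R), (forall i, measurable (E i)) ->
    P (\bigcap_(i in [set` J]) (Y i @^-1` E i))%classic
    = (\prod_(i <- J) P (Y i @^-1` E i)%classic)%E.

Definition symmetric_rv (X : {RV P >-> R}) : Prop :=
  forall E : set R, measurable E ->
    P (X @^-1` E)%classic = P ((fun w => - X w) @^-1` E)%classic.

(* MathComp-Analysis sets ln 0 = 0. A vanishing tail is nevertheless excluded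
   by the hypotheses put on U below: P{|Y_i| >= x} = 0 with x > 1 would give
   U i x = 0 = U i 0 and U i 1 = 1, against convexity. *)
Definition logtail (i : nat) (x : R) : R :=
  - ln (fine (P [set w | x <= `|Y i w|]%classic)).

End Process.

Section Tails.
Context {R : realType}.

(* The conditions on U_i, C0 being the regularity constant; the last one says
   that the right derivative of U_i at 0 exists (it does, by convexity) and is
   at least 1/C0. *)
Definition regular_tails (C0 : R) (U : nat -> R -> R) : Prop :=
  forall i,
    [/\ convex_function (`[0, +oo[%classic : set R) (U i),
        U i 0 = 0,
        U i 1 = 1,
        (forall s : R, 1 <= s -> U i (2 * s) <= C0 * U i s)
      & exists2 D : R, C0^-1 <= D &
          ((h^-1 * (U i h - U i 0)) @[h --> 0^'+] --> D)%classic].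

End Tails.

Section Balls.
Context {R : realType}.
Variable U : nat -> R -> R.
Implicit Types (t a : nat -> R).

Definition Uhat (i : nat) (x : R) : R :=
  if `|x| <= 1 then x ^+ 2 else 2 * U i `|x| - 1.

Definition ell2 t : Prop :=
  cvg (series (fun i => t i ^+ 2) @ \oo)%classic.

(* For t in l^2 and sum_i Uhat_i(a_i) <= u the sequence a is in l^2 as well, so
   the series sum_i t_i a_i converges and limn is its sum. *)
Definition Nnorm (u : R) t : \bar R :=
  ereal_sup [set (limn (series (fun i => t i * a i)))%:E | a in
    [set a : nat -> R | (\sum_(i <oo) (Uhat i (a i))%:E <= u%:E)%E]]%classic.

Definition Bset (u : R) : set (nat -> R) :=
  [set t : nat -> R | ell2 t /\ (Nnorm u t <= u%:E)%E]%classic.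

Definition dilate (c : R) (B : set (nat -> R)) : set (nat -> R) :=
  [set c *: b | b in B]%classic.

(* The infimum is +oo when no u is admissible, which does happen: if
   U_i(x) = x for all x >= 0, then N_u(t) > u for all u as soon as
   some |t_i| > 2. *)
Definition phi (r : R) (j : int) (s t : nat -> R) : \bar R :=
  ereal_inf [set u%:E | u in
    [set u : R | 0 < u /\ dilate (r ^ (- j)) (Bset u) (s - t)]]%classic.

End Balls.

Definition Ncard (n : nat) : nat := if n == 0%N then 1%N else (2 ^ 2 ^ n)%N.

Lemma Ncard_unbounded (m : nat) : exists n, (m <= Ncard n)%N.
Proof.
exists m; rewrite /Ncard; case: eqP => [-> //|_].
have h k : (k < 2 ^ k)%N by apply: ltn_expl.
by apply/ltnW/(ltn_trans (h m))/h.
Qed.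

Section Functionals.
Context {R : realType}.
Variables (U : nat -> R -> R) (r : R) (T : {fset (nat -> R)}).
Implicit Types (s t u x y : T) (n : nat) (j l : int) (A B : {set T}).

Definition phiT j s t : \bar R := phi U r j (val s) (val t).

Definition rball j s (c : R) : {set T} := [set t | (phiT j s t <= c%:E)%E].

(* 4 B_j(s, c): dilation about the centre s, restricted to T. *)
Definition dball j s (c : R) : {set T} :=
  [set t | (phi U r j (4^-1 *: (val s : nat -> R)) (4^-1 *: (val t : nat -> R)) <= c%:E)%E].

(* j_n(A), with value +oo exactly when every integer is admissible, for
   instance when A is a singleton. *)
Definition jlevel n A : \bar R :=
  ereal_sup [set (j%:~R : R)%:E | j in
    [set j : int | forall x y, x \in A -> y \in A -> (phiT j x y <= (2 ^+ n)%:E)%E]]%classic.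

(* r^(-z), with the convention r^(-oo) = 0. *)
Definition rpowN (z : \bar R) : \bar R :=
  match z with
  | z%:E => (r `^ (- z))%:E
  | +oo => 0
  | -oo => +oo
  end%E.

Definition admissible (A : nat -> {set {set T}}) : Prop :=
  forall n, [/\ finset.partition (A n) [set: T],
                (#|A n| <= Ncard n)%N
              & forall B, B \in A n.+1 -> exists2 C, C \in A n & B \subset C].

Definition gammaT : \bar R :=
  ereal_inf [set ereal_sup (range (fun t : T =>
      \sum_(n <oo) (2 ^+ n : R)%:E * rpowN (jlevel n (finset.pblock (A n) t))))
    | A in admissible]%classic%E.

(* For |T| >= 2 the supremum defining j_0(T) is a maximum; j0 is this integer. *)
Definition j0 : int :=
  xget 0 [set j : int | jlevel 0 [set: T] = (j%:~R : R)%:E]%classic.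

Definition nT : nat := ex_minn (Ncard_unbounded #|` T|).

Definition jT : int :=
  let sep (j : int) : Prop := forall x y, x != y -> ((2 ^+ nT)%:E < phiT j x y)%E in
  xget 0 [set j : int | sep j /\ forall l, sep l -> j <= l]%classic.

Section Construction.
Variables (kappa sigma : nat) (f : nat -> int -> T -> R).

(* The points of B_{j+1}(u, 2^n) still available to the greedy choice once the
   points of xs have been chosen. *)
Definition remaining n j u (xs : seq T) : {set T} :=
  rball (j + 1) u (2 ^+ n)
  :\: \bigcup_(x in xs) dball (j + sigma%:Z + 3) x (2 ^+ (n + kappa)).

(* xs = [:: x_1; ...; x_m] is a run of the greedy choice (ties between
   maximizers being broken arbitrarily); x_{m+1} is nth u xs m. *)
Definition greedy_run n j u (xs : seq T) : Prop :=
  forall m, (m < size xs)%N ->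
    nth u xs m \in remaining n j u (take m xs) /\
    forall y, y \in remaining n j u (take m xs) ->
      f (n + kappa) (j + sigma%:Z + 3) y
        <= f (n + kappa) (j + sigma%:Z + 3) (nth u xs m).

(* a is the value A_{n,j}(u) produced by some run: either the run stops early
   because nothing remains, or it is completed. *)
Definition greedy_value n j u (a : R) : Prop :=
  exists xs, greedy_run n j u xs /\
    ([/\ (size xs < Ncard (n + kappa))%N,
         remaining n j u xs = finset.set0
       & a = 0]
     \/
     (size xs = Ncard (n + kappa) /\
      a = 2 ^+ n * r ^ (- j - sigma%:Z - 1)
          + f (n + kappa) (j + sigma%:Z + 3) (last u xs))).

Definition zero_range n j : Prop :=
  ((nT + kappa < n)%N /\ j0 - sigma%:Z - 3 < j) \/ jT + sigma%:Z + 3 <= j.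

Record greedy_family : Prop := GreedyFamily {
  gf_zero : forall n j u, zero_range n j -> f n j u = 0;
  gf_step : forall n j u, ~ zero_range n j ->
    (n <= nT + kappa)%N ->
    j0 - sigma%:Z - 2 <= j -> j <= jT + sigma%:Z + 3 ->
    exists2 a, greedy_value n j u a &
      f n j u
      = Num.max (f (n + kappa) (j + 1) u) (Num.max a (f n (j + 1) u));
  gf_sup : forall n j u, j <= j0 - sigma%:Z - 3 ->
    f n j u
    = sup [set y : R | exists m l, j0 - sigma%:Z - 2 <= l /\ y = f m l u]%classic
}.

End Construction.
End Functionals.

(* Main.v *)
(** A chain of partitions refines every cell once per [kappa] units of [n].  A
    cell sitting in the ball B_{j+1}(u, 2^n) is cut by the greedy points of that
    ball: a piece near a greedy point passes to level j + sigma + 1 and is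
    recentred at one of its own points, while the leftover piece keeps [j] and
    [u] but has f_{n+kappa,j+sigma+3} <= f_{n,j}(u) - 2^n r^(-j-sigma-1).  Along
    the cells of a point [t], the weights a_k = 2^(k kappa) r^(-j_k) at least
    halve at the first kind of step and grow by the factor 2^kappa at the second
    one, so their sum is controlled by the steps of the second kind.

    As 2^kappa = 8 r, one has a_k = 8^k r^(-D_k) with D_k = j_k - k, and the
    decrements at two leftover steps k < l can be telescoped as soon as
    D_l >= D_k + sigma + 2.  Weights at steps that are followed by a leftover
    step with a smaller or equal D are absorbed geometrically by the last such
    step.  On the remaining steps D is strictly increasing, so that each residue
    class of D modulo sigma + 2 telescopes and contributes at most sup f. *)

Require Import Defs.
From mathcomp Require Import all_boot all_order all_algebra.
From mathcomp Require Import finmap.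
From mathcomp Require Import all_classical all_reals all_analysis.
From mathcomp Require Import zify ring lra.

Set Implicit Arguments.
Unset Strict Implicit.
Unset Printing Implicit Defensive.

Import Order.TTheory GRing.Theory Num.Theory.
Import numFieldNormedType.Exports.

Local Open Scope ring_scope.

(** * Summation lemmas *)

(** Telescoping of a potential [P] along the selected indices, which need not be consecutive. *)
Lemma sum_le_descent (R : realDomainType) (K : nat) (G : pred nat)
    (P w : nat -> R) (F : R) :
    0 <= F ->
    (forall k, (k < K)%N -> G k -> P k <= F) ->
    (forall k, (k < K)%N -> G k -> w k <= P k) ->
    (forall k l, (k < l < K)%N -> G k -> G l -> P l + w k <= P k) ->
  \sum_(0 <= k < K | G k) w k <= F.
Proof.
move=> F0 PF wP step.
(* [x] stands for the part of the sum already treated from the top. At a selected [K] the new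
   remainder [w K + x] is replaced by its bound [P K], which the descent hypothesis then compares
   with every smaller selected index. *)
suff H x : x <= F -> (forall k, (k < K)%N -> G k -> w k + x <= P k) ->
    \sum_(0 <= k < K | G k) w k + x <= F.
  by rewrite -[leLHS]addr0; apply: H => // k kK Gk; rewrite addr0 wP.
elim: K x PF wP step => [|K IH] x PF wP step xF xP; first by rewrite big_geq ?add0r.
have PF' k : (k < K)%N -> G k -> P k <= F by move=> kK; apply: PF; lia.
have wP' k : (k < K)%N -> G k -> w k <= P k by move=> kK; apply: wP; lia.
have step' k l : (k < l < K)%N -> G k -> G l -> P l + w k <= P k.
  by move=> kl; apply: step; lia.
rewrite big_mkcond big_nat_recr //= -big_mkcond /=.
case: ifPn => GK; last first.
  by rewrite addr0; apply: IH => // k kK; apply: xP; lia.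
rewrite -addrA; apply: (@le_trans _ _ (\sum_(0 <= k < K | G k) w k + P K)).
  by rewrite lerD2l xP.
apply: IH => //; first exact: PF.
by move=> k kK Gk; rewrite addrC; apply: step => //; rewrite kK ltnSn.
Qed.

Lemma sum_half_powers_le2 (R : realFieldType) (N : nat) :
  \sum_(0 <= k < N) (2^-1 : R) ^+ k <= 2.
Proof.
suff -> : \sum_(0 <= k < N) (2^-1 : R) ^+ k = 2 - 2 * 2^-1 ^+ N.
  by rewrite gerBl mulr_ge0 // exprn_ge0 // invr_ge0.
elim: N => [|N IH]; first by rewrite big_geq // expr0; lra.
by rewrite big_nat_recr //= IH exprS; lra.
Qed.

Section ChainSum.
Variables (R : realFieldType) (K s : nat) (D : nat -> int) (b : pred nat).
Variables (r : R) (P : nat -> R) (w F : R).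
Hypotheses (r1 : 1 <= r) (w0 : 0 <= w) (F0 : 0 <= F).

Let a k : R := 8 ^+ k * r ^ (- D k).

Hypothesis PF : forall k, (k < K)%N -> b k -> P k <= F.
Hypothesis aP : forall k, (k < K)%N -> b k -> w * a k <= P k.
Hypothesis aPP : forall k l, (k < l < K)%N -> b k -> b l ->
  D k + s%:Z + 1 <= D l -> P l + w * a k <= P k.

(* The marked steps that no later marked step [l] with [D l <= D k] dominates. *)
Let G k := b k && [forall l : 'I_K, (k < l)%N && b l ==> (D k < D l)].

Let r_gt0 : 0 < r. Proof. exact: lt_le_trans r1. Qed.

Let a_ge0 k : 0 <= a k.
Proof. by rewrite mulr_ge0 ?exprn_ge0 // exprz_ge0 // ltW. Qed.

(** On [G] the integers [D k] increase strictly with [k], so two indices whose [D] agree modulo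
    [s.+1] differ in [D] by at least [s.+1]. Each of the [s.+1] residue classes is thus a descent
    for [P] and contributes at most [F]. *)
Let sum_minima : w * \sum_(0 <= k < K | G k) a k <= s.+1%:R * F.
Proof.
have inj k l : (k < l < K)%N -> G k -> G l -> D k < D l.
  case/andP=> kl lK /andP[_ /forallP/(_ (Ordinal lK))/= +] /andP[bl _].
  by rewrite kl bl.
pose c k : 'I_s.+1 := inord (absz (D k %% s.+1%:Z)%Z).
rewrite big_mkord.
rewrite (partition_big (fun k : 'I_K => c k) xpredT) //= mulr_sumr.
rewrite -[s.+1 in leRHS]card_ord mulr_natl -sumr_const.
apply: ler_sum => i _.
rewrite mulr_sumr -(big_mkord (fun k => G k && (c k == i)) (fun k => w * a k)).
apply: (@sum_le_descent _ _ _ P) => //.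
- by move=> k kK /andP[/andP[bk _] _]; exact: PF.
- by move=> k kK /andP[/andP[bk _] _]; exact: aP.
move=> k l klK /andP[Gk /eqP ck] /andP[Gl /eqP cl].
have := inj _ _ klK Gk Gl; case/andP: Gk Gl => bk _ /andP[bl _] Dkl.
apply: aPP => //.
have : nat_of_ord (c k) = c l by rewrite ck cl.
have lt k' : (`|(D k' %% s.+1%:Z)%Z| < s.+1)%N.
  have := ltz_pmod (D k') (isT : 0 < s.+1%:Z); have := modz_ge0 (D k') (isT : s.+1%:Z != 0).
  lia.
rewrite /c !inordK //.
have := divz_eq (D k) s.+1; have := divz_eq (D l) s.+1.
have := modz_ge0 (D k) (isT : s.+1%:Z != 0).
have := modz_ge0 (D l) (isT : s.+1%:Z != 0).
move: (D k %/ _)%Z (D k %% _)%Z (D l %/ _)%Z (D l %% _)%Z => q e q' e' *.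
have : e = e' by lia.
move=> ?; subst e'.
have : (q < q')%R by nia.
nia.
Qed.

Let sum_marked : \sum_(0 <= k < K | b k) a k <= 2 * \sum_(0 <= k < K | G k) a k.
Proof.
rewrite !big_mkord mulr_sumr.
have dom (k : 'I_K) : b k -> exists2 g : 'I_K, G g && (k <= g)%N & a k <= 2^-1 ^+ (g - k) * a g.
  move=> bk.
  (* The dominating index is the last marked [g >= k] with [D g <= D k]. It lies in [G], since a
     later marked [l] with [D l <= D g] would contradict maximality. As [8 = 2 * 4], the factor
     [2^-(g - k)] still leaves [4^(g - k) >= 1] to spare. *)
  case: (@arg_maxnP _ k (fun l : 'I_K => [&& b l, (k <= l)%N & D l <= D k]) (fun l => l : nat)).
    by rewrite bk leqnn lexx.
  move=> g /and3P[bg kg Dg] gmax; exists g.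
    rewrite kg andbT /G bg; apply/forallP => l; apply/implyP => /andP[gl bl].
    rewrite ltNge; apply/negP => Dlg.
    have /gmax : [&& b l, (k <= l)%N & D l <= D k] by rewrite bl (le_trans Dlg Dg); lia.
    by rewrite /= leqNgt gl.
  have e : r ^ (- D k) <= r ^ (- D g) by apply: ler_weXz2l => //; lia.
  have -> : 2^-1 ^+ (g - k) * a g = 8 ^+ k * (4 ^+ (g - k) * r ^ (- D g)).
    rewrite /a -{2}(subnK kg) exprD.
    have -> : (8 : R) = 2 * 4 by ring.
    by rewrite !exprMn exprVn; field; rewrite expf_neq0.
  rewrite ler_pM2l ?exprn_gt0 //; apply: (le_trans e).
  rewrite ler_peMl ?exprn_ege1 //; first by rewrite exprz_ge0 // ltW.
  lra.
(* After exchanging the sums, each [g] of [G] collects a geometric series over the indices it may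
   dominate. *)
apply: (@le_trans _ _ (\sum_(k < K | b k) \sum_(g < K | G g && (k <= g)%N)
   2^-1 ^+ (g - k) * a g)).
  apply: ler_sum => k /dom[g Gg] /le_trans; apply.
  by rewrite (bigD1 g) //= lerDl sumr_ge0 // => i _; rewrite mulr_ge0 ?exprn_ge0 ?invr_ge0.
rewrite (exchange_big_dep (fun g : 'I_K => G g)) /=; last by move=> k g _ /andP[].
apply: ler_sum => g Gg; rewrite -mulr_suml; apply: ler_wpM2r => //.
apply: le_trans (sum_half_powers_le2 R g.+1).
rewrite big_mkord [leRHS](reindex_inj rev_ord_inj) /=.
apply: (@le_trans _ _ (\sum_(k < K | (k <= g)%N) 2^-1 ^+ (g - k))).
  rewrite [leLHS]big_mkcond [leRHS]big_mkcond /=.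
  by apply: ler_sum => k _; rewrite Gg; case: (b k); case: ifP; rewrite ?exprn_ge0 ?invr_ge0.
by rewrite [leRHS](big_ord_widen K (fun k => 2^-1 ^+ (g.+1 - k.+1))) //;
  under [leRHS]eq_bigr do rewrite subSS.
Qed.

Lemma sum_marked_le : w * \sum_(0 <= k < K | b k) a k <= 2 * s.+1%:R * F.
Proof.
apply: (@le_trans _ _ (w * (2 * \sum_(0 <= k < K | G k) a k))); first exact: ler_wpM2l.
by rewrite mulrCA -mulrA ler_pM2l // sum_minima.
Qed.

End ChainSum.

(** The shift by one fits the indexing [n.-1 %/ kappa] of the partitions: block [k] consists of the
    [n] with [(n - 1) %/ m = k]. *)
Lemma sum_blocks (R : nmodType) (h : nat -> R) (m K : nat) :
  \sum_(0 <= n < (K * m).+1) h n =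
  h 0%N + \sum_(0 <= k < K) \sum_(0 <= i < m) h (k * m + i).+1.
Proof.
elim: K => [|K IH]; first by rewrite mul0n big_nat1 [X in _ + X]big_geq ?addr0.
rewrite [in RHS]big_nat_recr //= addrA -IH.
rewrite (@big_cat_nat _ _ _ (K * m).+1) //=; last by rewrite ltnS leq_mul2r leqnSn orbT.
congr (_ + _); rewrite -{1}[(K * m).+1]add0n big_addn mulSn subSS addnK.
by apply: eq_bigr => i _; rewrite addnS addnC.
Qed.

(** Summing the step inequality bounds the sum by [a 0], the marked part, and half of the sum
    itself, which is absorbed on the left. *)
Lemma sum_le_of_steps (R : realFieldType) (a : nat -> R) (b : pred nat) (beta : R) K :
  (forall k, 0 <= a k) -> 0 <= beta ->
  (forall k, a k.+1 <= if b k then beta * a k else 2^-1 * a k) ->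
  \sum_(0 <= k < K) a k <= 2 * a 0%N + 2 * beta * \sum_(0 <= k < K | b k) a k.
Proof.
move=> a0 beta0 step.
have b0 : 0 <= beta * \sum_(0 <= k < K | b k) a k.
  by rewrite mulr_ge0 // sumr_ge0.
have le1 : \sum_(0 <= k < K) a k <= \sum_(0 <= k < K.+1) a k.
  by rewrite big_nat_recr //= lerDl.
have : \sum_(0 <= k < K.+1) a k <=
    a 0%N + (beta * \sum_(0 <= k < K | b k) a k + 2^-1 * \sum_(0 <= k < K) a k).
  rewrite big_nat_recl // lerD2l [X in beta * X]big_mkcond !mulr_sumr -big_split /=.
  apply: ler_sum => k _; apply: le_trans (step k) _.
  case: ifP => _; first by rewrite lerDl mulr_ge0 // invr_ge0.
  by rewrite mulr0 add0r.
lra.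
Qed.

(** * Geometry of the balls *)

Section SquareSummable.
Context {R : realType}.
Implicit Types s t a : nat -> R.

Definition pairing t a : R := limn (series (fun i => t i * a i)).

Lemma ell2Z c t : ell2 t -> ell2 (c *: t).
Proof.
rewrite /ell2 => ht.
have -> : (fun i => (c *: t) i ^+ 2) = c ^+ 2 *: (fun i => t i ^+ 2).
  by apply/funext => i; rewrite !fctE exprMn.
exact: is_cvg_seriesZ.
Qed.

Lemma ell2D s t : ell2 s -> ell2 t -> ell2 (s + t).
Proof.
rewrite /ell2 => hs ht.
apply: (@series_le_cvg _ _ (2 *: (fun i => s i ^+ 2) + 2 *: (fun i => t i ^+ 2))).
- by move=> i; rewrite sqr_ge0.
- by move=> i; rewrite !fctE addr_ge0 // mulr_ge0 ?sqr_ge0.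
- move=> i; rewrite !fctE /GRing.scale /=.
  rewrite -subr_ge0.
  have -> : 2 * s i ^+ 2 + 2 * t i ^+ 2 - (s i + t i) ^+ 2 = (s i - t i) ^+ 2 by ring.
  exact: sqr_ge0.
- by apply: is_cvg_seriesD; apply: is_cvg_seriesZ.
Qed.

Lemma ell2B s t : ell2 s -> ell2 t -> ell2 (s - t).
Proof. by move=> hs ht; rewrite -scaleN1r; apply: ell2D => //; apply: ell2Z. Qed.

Lemma pairing_cvg t a : ell2 t -> ell2 a -> cvgn (series (fun i => t i * a i)).
Proof.
move=> ht ha; apply: normed_cvg.
apply: (@series_le_cvg _ _ (2^-1 *: ((fun i => t i ^+ 2) + (fun i => a i ^+ 2)))).
- by move=> i; rewrite normr_ge0.
- by move=> i; rewrite !fctE mulr_ge0 ?invr_ge0 ?addr_ge0 ?sqr_ge0.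
- move=> i; rewrite !fctE /GRing.scale /= normrM -(real_normK (num_real (t i))).
  rewrite -(real_normK (num_real (a i))) -subr_ge0.
  set x := `|t i|; set y := `|a i|.
  have -> : 2^-1 * (x ^+ 2 + y ^+ 2) - x * y = 2^-1 * (x - y) ^+ 2 by field.
  by rewrite mulr_ge0 ?invr_ge0 ?sqr_ge0.
- by apply: is_cvg_seriesZ; apply: is_cvg_seriesD.
Qed.

Lemma pairingZl c t a : ell2 t -> ell2 a -> pairing (c *: t) a = c * pairing t a.
Proof.
move=> ht ha; rewrite /pairing.
have -> : (fun i => (c *: t) i * a i) = c *: (fun i => t i * a i).
  by apply/funext => i; rewrite !fctE /GRing.scale /= mulrA.
by rewrite lim_seriesZ //; apply: pairing_cvg.
Qed.

Lemma pairingZr c t a : ell2 t -> ell2 a -> pairing t (c *: a) = c * pairing t a.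
Proof.
move=> ht ha; rewrite -pairingZl // /pairing; congr (limn (series _)).
by apply/funext => i; rewrite !fctE /GRing.scale /= mulrCA mulrA.
Qed.

Lemma pairingB s t a : ell2 s -> ell2 t -> ell2 a ->
  pairing (s - t) a = pairing s a - pairing t a.
Proof.
move=> hs ht ha; rewrite /pairing -lim_seriesB; try exact: pairing_cvg.
by congr (limn (series _)); apply/funext => i; rewrite !fctE mulrBl.
Qed.

End SquareSummable.

(** * Tails, test sequences and the balls B(u) *)

Section Tails.
Context {R : realType}.
Variables (C0 : R) (U : nat -> R -> R).
Hypothesis regU : regular_tails C0 U.

(** Convexity of [U i] between [0] and [x], with [U i 0 = 0]. *)
Lemma tail_scale i (l x : R) : 0 <= l <= 1 -> 0 <= x -> U i (l * x) <= l * U i x.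
Proof.
case: (regU i) => cvx U0 _ _ _ /andP[l0 l1] x0.
have := cvx (Itv01 l0 l1) x 0; rewrite !inE /= !in_itv /= !andbT lexx x0.
move=> /(_ isT isT); rewrite !convRE /= U0 !mulr0 !addr0.
by rewrite /conv /= /GRing.scale /= mulr0 addr0.
Qed.

Lemma tail_ge i (x : R) : 1 <= x -> x <= U i x.
Proof.
move=> x1; have x0 : 0 < x by apply: lt_le_trans x1.
have := @tail_scale i x^-1 x; rewrite invr_ge0 invf_le1 // (ltW x0) x1 mulVf ?gt_eqF //.
by move=> /(_ isT isT); case: (regU i) => _ _ -> _ _; rewrite ler_pdivlMl // mulr1.
Qed.

Local Notation Uh := (Uhat U).

Lemma Uhat_ge_norm i x : 1 <= `|x| -> `|x| <= Uh i x.
Proof.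
move=> x1; rewrite /Uhat; case: ifPn => [x1'|_].
  have e : `|x| = 1 by apply/eqP; rewrite eq_le x1 x1'.
  by rewrite -(real_normK (num_real x)) e expr1n.
have := tail_ge i x1; lra.
Qed.

Lemma Uhat_small i x : `|x| <= 1 -> Uh i x = x ^+ 2.
Proof. by rewrite /Uhat => ->. Qed.

Lemma Uhat_ge0 i x : 0 <= Uh i x.
Proof.
have [x1|x1] := leP `|x| 1; first by rewrite Uhat_small // sqr_ge0.
by apply: le_trans (Uhat_ge_norm i (ltW x1)).
Qed.

Lemma UhatN i x : Uh i (- x) = Uh i x.
Proof. by rewrite /Uhat normrN sqrrN. Qed.

(** In the mixed case [l |x| <= 1 < |x|], one has [(l x)^2 <= l |x|], and
    [|x| <= U i |x| <= 2 U i |x| - 1] finishes. Through [KsetZ] this makes the balls increasing in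
    their radius. *)
Lemma Uhat_scale i (l x : R) : 0 <= l <= 1 -> Uh i (l * x) <= l * Uh i x.
Proof.
move=> /[dup] l01 /andP[l0 l1]; rewrite /Uhat normrM (ger0_norm l0).
have lx : l * `|x| <= `|x| by rewrite ler_piMl.
have [x1|x1] := leP `|x| 1.
  rewrite (le_trans lx x1) exprMn ler_wpM2r ?sqr_ge0 //.
  by rewrite expr2 ler_piMl.
have := tail_ge i (ltW x1); have := tail_scale i l01 (normr_ge0 x).
case: ifPn => lx1 h1 h2; last nra.
rewrite exprMn -(real_normK (num_real x)).
have := ler_wpM2r (normr_ge0 x) lx1; rewrite mul1r => h3.
rewrite !expr2 mulrACA -mulrA ler_wpM2l // mulrA; lra.
Qed.

(** The test sequences of [Nnorm], written with real partial sums; the terms being nonnegative,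
    [KsetP] identifies this with the condition on the extended-real series. *)
Definition Kset (v : R) (a : nat -> R) := forall n, \sum_(0 <= i < n) Uh i (a i) <= v.

Lemma KsetP v a : (\sum_(i <oo) (Uh i (a i))%:E <= v%:E)%E <-> Kset v a.
Proof.
split=> [h n|h].
  rewrite -lee_fin -sumEFin; apply: le_trans h.
  by apply: nneseries_lim_ge => k _ _; rewrite lee_fin Uhat_ge0.
apply: lime_le; first by apply: is_cvg_nneseries => k _ _; rewrite lee_fin Uhat_ge0.
by apply: nearW => n; rewrite sumEFin lee_fin.
Qed.

Lemma Kset_Uhat_le v a i : Kset v a -> Uh i (a i) <= v.
Proof.
move=> /(_ i.+1); rewrite big_nat_recr //=; apply: le_trans.
by rewrite lerDr sumr_ge0 // => k _; rewrite Uhat_ge0.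
Qed.

(** For [|a i| > 1], one factor [|a i|] is at most [Uh i (a i)] and the other at most [v]. Hence
    test sequences are in l^2 and the pairing converges. *)
Lemma Kset_sqr_le v a i : 1 <= v -> Kset v a -> a i ^+ 2 <= v * Uh i (a i).
Proof.
move=> v1 Ka; have U0 := Uhat_ge0 i (a i).
have [x1|x1] := leP `|a i| 1; first by rewrite Uhat_small // ler_peMl // sqr_ge0.
have h := Uhat_ge_norm i (ltW x1); have hv := Kset_Uhat_le i Ka.
rewrite -(real_normK (num_real (a i))) expr2.
by apply: ler_pM => //; apply: le_trans hv.
Qed.

Lemma Kset_sum_sqr_le v a n : 1 <= v -> Kset v a ->
  \sum_(0 <= i < n) a i ^+ 2 <= v ^+ 2.
Proof.
move=> v1 Ka; apply: (@le_trans _ _ (v * \sum_(0 <= i < n) Uh i (a i))).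
  by rewrite mulr_sumr ler_sum // => i _; exact: Kset_sqr_le.
by rewrite expr2 ler_wpM2l ?Ka // (le_trans _ v1).
Qed.

Lemma Kset_le u v a : u <= v -> Kset u a -> Kset v a.
Proof. by move=> uv Ka n; apply: le_trans uv. Qed.

Lemma Kset_ell2 v a : Kset v a -> ell2 a.
Proof.
move=> Ka; have Ka' : Kset (Num.max 1 v) a by apply: Kset_le Ka; rewrite le_max lexx orbT.
apply: nondecreasing_is_cvgn.
  by apply: nondecreasing_series => i _ _; rewrite sqr_ge0.
exists ((Num.max 1 v) ^+ 2) => _ [n _ <-]; apply: Kset_sum_sqr_le => //.
by rewrite le_max lexx.
Qed.

Lemma KsetN v a : Kset v a -> Kset v (- a).
Proof.
move=> Ka n; apply: le_trans (Ka n).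
by apply: ler_sum => i _; rewrite !fctE UhatN.
Qed.

Lemma KsetZ v l a : 0 <= l <= 1 -> Kset v a -> Kset (l * v) (l *: a).
Proof.
move=> l01 Ka n; apply: (@le_trans _ _ (l * \sum_(0 <= i < n) Uh i (a i))).
  by rewrite mulr_sumr ler_sum // => i _; exact: Uhat_scale.
by rewrite ler_wpM2l //; case/andP: l01.
Qed.

Local Notation B := (Bset U).

Lemma BsetP v t : B v t <-> ell2 t /\ forall a, Kset v a -> pairing t a <= v.
Proof.
rewrite /Bset /Nnorm /=; split=> [] [ht h]; split=> //.
  move=> a Ka; rewrite -lee_fin; apply: le_trans h.
  by apply: ereal_sup_ubound; exists a => //; exact/KsetP.
by apply: ge_ereal_sup => _ [a /KsetP Ka <-]; rewrite lee_fin; exact: h.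
Qed.

(** The test set is symmetric, so a difference of two points of B(v) pairs to at most [2 v], and
    [c <= 1/2] compensates. *)
Lemma Bset_subZ v c s t : 0 < v -> 0 <= c <= 2^-1 -> B v s -> B v t -> B v (c *: (s - t)).
Proof.
move=> v0 /andP[c0 c1] /BsetP[hs Hs] /BsetP[ht Ht]; apply/BsetP.
split=> [|a Ka]; first by apply: ell2Z; apply: ell2B.
have ha := Kset_ell2 Ka.
rewrite pairingZl //; last exact: ell2B.
rewrite pairingB //; have := Hs _ Ka; have := Ht _ (KsetN Ka).
rewrite -scaleN1r pairingZr //; nra.
Qed.

Lemma BsetZ v c t : 0 < v -> 0 <= c <= 1 -> B v t -> B v (c *: t).
Proof.
move=> v0 /andP[c0 c1] /BsetP[ht Ht]; apply/BsetP.
split=> [|a Ka]; first exact: ell2Z.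
by rewrite pairingZl //; [have := Ht _ Ka; nra | exact: Kset_ell2 Ka].
Qed.

(** The test sequence is shrunk: if [a] is in [Kset v] then [(u / v) a] is in [Kset u]. *)
Lemma Bset_le u v t : 0 < u -> u <= v -> B u t -> B v t.
Proof.
move=> u0 uv /BsetP[ht Ht]; apply/BsetP; split=> // a Ka.
have v0 : 0 < v by apply: lt_le_trans uv.
have : Kset u ((u / v) *: a).
  have := KsetZ (_ : 0 <= u / v <= 1) Ka; rewrite divfK ?gt_eqF //; apply.
  by rewrite divr_ge0 ?(ltW u0) ?(ltW v0) // ler_pdivrMr // mul1r.
move=> /Ht; rewrite pairingZr //; last exact: Kset_ell2 Ka.
by rewrite mulrAC ler_pdivrMr // ler_pM2l.
Qed.

Lemma Bset0 v : 0 < v -> B v 0.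
Proof.
move=> v0; have e0 : ell2 (0 : nat -> R).
  rewrite /ell2 (_ : series _ = cst 0); first exact: is_cvg_cst.
  by apply/funext => n; rewrite /series /= big1 // => i _; rewrite expr0n.
apply/BsetP; split=> // a Ka; rewrite -(scale0r 0) pairingZl ?mul0r ?(ltW v0) //.
exact: Kset_ell2 Ka.
Qed.

(** Tested on plus and minus the [i]-th unit vector, whose [Uhat] sum is [1 <= v]. *)
Lemma Bset_coord v t i : 1 <= v -> B v t -> `|t i| <= v.
Proof.
move=> v1 /BsetP[ht Ht].
pose e (c : R) : nat -> R := fun k => if k == i then c else 0.
have Ke c : `|c| = 1 -> Kset v (e c).
  move=> c1 n; apply: le_trans v1.
  have E k : Uh k (e c k) = if k == i then 1 else 0.
    rewrite /e; case: eqP => _.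
      by rewrite Uhat_small ?c1 // -(real_normK (num_real c)) c1 expr1n.
    by rewrite Uhat_small ?normr0 // expr0n.
  under eq_bigr do rewrite E.
  by rewrite -big_mkcond big_nat1_eq; case: ifP.
have te c : pairing t (e c) = t i * c.
  apply: lim_near_cst => //; exists i.+1 => // n /= ni.
  rewrite /series /= (eq_bigr (fun k => if k == i then t k * c else 0)); last first.
    by move=> k _; rewrite /e; case: eqP; rewrite ?mulr0.
  by rewrite -big_mkcond big_nat1_eq ni.
have h c : `|c| = 1 -> t i * c <= v by move=> c1; rewrite -te; exact/Ht/Ke.
have := h 1; have := h (-1); rewrite normrN normr1 => /(_ erefl) h1 /(_ erefl) h2.
by rewrite ler_norml; apply/andP; split; lra.
Qed.

(** By [2 c t_i a_i <= c^2 t_i^2 + a_i^2], where the squares of [a] sum to at most 1. With [L] the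
    squared norm of [t], the choice [e = 1 / (1 + L)] gives [c L <= 1] and [c <= 1], hence
    [c^2 L <= 1]. *)
Lemma Bset_absorb t : ell2 t -> exists2 e : R, 0 < e & forall c, 0 <= c <= e -> B 1 (c *: t).
Proof.
move=> ht; set L := limn (series (fun i => t i ^+ 2)).
have L0 : 0 <= L.
  by apply: limr_ge => //; apply: nearW => n; apply: sumr_ge0 => i _; rewrite sqr_ge0.
exists (1 + L)^-1; first by rewrite invr_gt0 ltr_pwDl.
move=> c /andP[c0 ce]; apply/BsetP; split=> [|a Ka]; first exact: ell2Z.
have cL : c * L <= 1.
  apply: (@le_trans _ _ ((1 + L)^-1 * L)); first by rewrite ler_wpM2r.
  by rewrite mulrC ler_pdivrMr ?ltr_pwDl // mul1r lerDr.
have ha := Kset_ell2 Ka.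
apply: limr_le; first by apply: pairing_cvg => //; exact: ell2Z.
apply: nearW => n.
have S : \sum_(0 <= i < n) t i ^+ 2 <= L.
  by apply: nondecreasing_cvgn_le => //; apply: nondecreasing_series => i _ _; rewrite sqr_ge0.
have Sa := Kset_sum_sqr_le n (lexx 1) Ka.
apply: (@le_trans _ _
  (2^-1 * (c ^+ 2 * (\sum_(0 <= i < n) t i ^+ 2) + \sum_(0 <= i < n) a i ^+ 2))).
  rewrite mulr_sumr -big_split mulr_sumr; apply: ler_sum => i _ /=.
  rewrite !fctE /GRing.scale /= -subr_ge0.
  have -> : 2^-1 * (c ^+ 2 * t i ^+ 2 + a i ^+ 2) - c * t i * a i =
    2^-1 * (c * t i - a i) ^+ 2 by field.
  by rewrite mulr_ge0 ?invr_ge0 ?sqr_ge0.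
have c1 : c <= 1 by apply: (le_trans ce); rewrite invf_le1 ?ltr_pwDl // lerDl.
rewrite expr1n in Sa.
have : c ^+ 2 * (\sum_(0 <= i < n) t i ^+ 2) <= 1.
  have : c * (\sum_(0 <= i < n) t i ^+ 2) <= 1 by apply: le_trans cL; rewrite ler_wpM2l.
  rewrite expr2 -mulrA; nra.
lra.
Qed.

End Tails.

(** * The distances phi_j *)

Section Phi.
Context {R : realType}.
Variables (C0 : R) (U : nat -> R -> R) (r : R).
Hypothesis regU : regular_tails C0 U.
Hypothesis r4 : 4 <= r.

Local Notation B := (Bset U).
Local Notation phi := (phi U r).
Implicit Types (j l : int) (s t x : nat -> R) (c v : R).

Let r_gt0 : 0 < r. Proof. by apply: lt_le_trans r4. Qed.
Let r_ge1 : 1 <= r. Proof. by apply: le_trans r4; rewrite ler1n. Qed.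
Let r_neq0 : r != 0. Proof. by rewrite gt_eqF. Qed.

(** Membership for all [v > c] replaces membership at [c], which avoids asking whether the infimum
    is attained. *)
Lemma phi_leP j s t c : 0 < c ->
  (phi j s t <= c%:E)%E <-> (forall v, c < v -> B v (r ^ j *: (s - t))).
Proof.
move=> c0; split=> [h v cv|h].
  have : (phi j s t < v%:E)%E by apply: le_lt_trans h _; rewrite lte_fin.
  move=> /ereal_inf_lt[_ [u [u0 [b Bb bE]] <-]]; rewrite lte_fin => uv.
  rewrite -bE scalerA -expfzDr // subrr expr0z scale1r.
  exact: Bset_le regU _ _ _ u0 (ltW uv) Bb.
apply/lee_addgt0Pr => e e0; rewrite -EFinD.
apply: ereal_inf_lbound; exists (c + e) => //; split; first by rewrite addr_gt0.
exists (r ^ j *: (s - t)); first by apply: h; rewrite ltrDl.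
by rewrite scalerA -expfzDr // addNr expr0z scale1r.
Qed.

Lemma phi_le_trans j l s t c : 0 < c -> j <= l ->
  (phi l s t <= c%:E)%E -> (phi j s t <= c%:E)%E.
Proof.
move=> c0 jl /(phi_leP _ _ _ c0) h; apply/phi_leP => // v cv.
have -> : r ^ j = r ^ (j - l) * r ^ l by rewrite -expfzDr // subrK.
rewrite -scalerA; apply: BsetZ regU _ _ _ _ _ (h v cv); first exact: lt_trans cv.
rewrite exprz_ge0 ?(ltW r_gt0) //=; apply: (@le_trans _ _ (r ^ 0)); last by rewrite expr0z.
by apply: ler_weXz2l; [exact: r_ge1 | lia].
Qed.

Lemma phi_xx j x c : 0 < c -> (phi j x x <= c%:E)%E.
Proof.
move=> c0; apply/phi_leP => // v cv; rewrite subrr scaler0.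
by apply: Bset0 regU _ _; exact: lt_trans cv.
Qed.

(** A triangle inequality without loss in the radius: dropping one level gains a factor
    [r^-1 <= 1/2], which pays for the difference. *)
Lemma phi_quasi j x s t c : 0 < c ->
  (phi (j + 1) x s <= c%:E)%E -> (phi (j + 1) x t <= c%:E)%E -> (phi j s t <= c%:E)%E.
Proof.
move=> c0 /(phi_leP _ _ _ c0) hs /(phi_leP _ _ _ c0) ht; apply/phi_leP => // v cv.
have -> : r ^ j *: (s - t) = r^-1 *: (r ^ (j + 1) *: (x - t) - r ^ (j + 1) *: (x - s)).
  rewrite -scalerBr scalerA expfzDr // expr1z mulrCA mulVf // mulr1.
  by congr (_ *: _); rewrite opprB [RHS]addrC addrA subrK.
apply: Bset_subZ regU _ _ _ _ _ _ (ht v cv) (hs v cv); first exact: lt_trans cv.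
rewrite invr_ge0 (ltW r_gt0) lef_pV2 ?posrE //=; have := r4; lra.
Qed.

(** Points of one dilated ball of radius [8 r c] are [c]-close one level lower. The contraction
    hypothesis writes [r^j (s - t)] as [4 rho] times a difference of two points of B(v), and
    [4 rho < 1/2]. *)
Lemma phi_dilate (rho : R) j x s t c :
  0 < rho < 10^-1 ->
  (forall u : R, 0 < u -> (B (8 * r * u) `<=` dilate (rho * r) (B u))%classic) ->
  0 < c ->
  (phi (j + 1) (4^-1 *: x) (4^-1 *: s) <= (8 * r * c)%:E)%E ->
  (phi (j + 1) (4^-1 *: x) (4^-1 *: t) <= (8 * r * c)%:E)%E -> (phi j s t <= c%:E)%E.
Proof.
have r8 : 0 < 8 * r by rewrite mulr_gt0.
move=> rhoP BsetM c0 /(phi_leP _ _ _ (mulr_gt0 r8 c0)) hs /(phi_leP _ _ _ (mulr_gt0 r8 c0)) ht.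
apply/phi_leP => // v cv; have v0 : 0 < v by exact: lt_trans cv.
have cv' : 8 * r * c < 8 * r * v by rewrite ltr_pM2l.
have [bs Bs sE] := BsetM _ v0 _ (hs _ cv'); have [bt Bt tE] := BsetM _ v0 _ (ht _ cv').
have -> : r ^ j *: (s - t) = (4 * rho) *: (bt - bs).
  have E : (r ^ (j + 1) / 4) *: (s - t) = (rho * r) *: (bt - bs).
    rewrite [RHS]scalerBr sE tE -scalerBr -scalerA; congr (_ *: _).
    rewrite -!scalerBr; congr (_ *: _).
    by rewrite opprB [RHS]addrC addrA subrK.
  have -> : r ^ j = (4 / r) * (r ^ (j + 1) / 4) by rewrite expfzDr // expr1z; field.
  by rewrite -scalerA E scalerA; congr (_ *: _); field.
by apply: (Bset_subZ regU) => //; case/andP: rhoP => *; apply/andP; split; lra.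
Qed.

Lemma exists_exprz_le (e : R) : 0 < e -> exists j, r ^ j <= e.
Proof.
move=> e0; exists (- (Num.bound e^-1)%:Z).
rewrite -exprnN invf_ple ?posrE ?exprn_gt0 //.
apply/ltW/(lt_le_trans (upper_nthrootP (leqnn _))).
by rewrite lerXn2r ?nnegrE //; have := r4; lra.
Qed.

Lemma phi_le1 s t : ell2 s -> ell2 t ->
  exists l, forall j, j <= l -> (phi j s t <= 1%:E)%E.
Proof.
move=> hs ht; have [e e0 he] := Bset_absorb regU (ell2B hs ht).
have [l le] := exists_exprz_le e0; exists l => j jl.
apply: phi_le_trans jl _ => //; apply/phi_leP => // v v1.
apply: (Bset_le regU _ (ltW v1)) => //; apply: he.
by rewrite exprz_ge0 // ltW.
Qed.

Lemma phi_gt s t c : 0 < c -> s <> t ->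
  exists l, forall j, l <= j -> (c%:E < phi j s t)%E.
Proof.
move=> c0 st.
have [i sti] : exists i, s i - t i != 0.
  apply: contrapT => h; apply: st; apply/funext => i; apply/eqP; rewrite -subr_eq0.
  by apply: contrapT => /negP hi; apply: h; exists i.
(* Membership is tested at radius [c + 1], which is at least 1 as [Bset_coord] requires; the larger
   [c + 2] makes the contradiction strict. *)
have d0 : 0 < `|s i - t i| / (c + 2) by rewrite divr_gt0 ?normr_gt0 ?addr_gt0.
have [l le] := exists_exprz_le d0; exists (- l) => j lj; rewrite ltNge; apply/negP.
move=> /(phi_le_trans c0 lj)/(phi_leP _ _ _ c0)/(_ (c + 1)).
rewrite ltrDl => /(_ ltr01)/(Bset_coord regU i).
rewrite lerDr (ltW c0) => /(_ isT); rewrite !fctE /GRing.scale /= normrM.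
rewrite ger0_norm ?exprz_ge0 ?(ltW r_gt0) // => h.
have rl0 : 0 < r ^ l by rewrite exprz_gt0.
have : `|s i - t i| <= (c + 1) * r ^ l.
  have := ler_wpM2l (ltW rl0) h; rewrite mulrA -expfzDr // subrr expr0z mul1r mulrC.
  by rewrite mulrC.
move: le; rewrite ler_pdivlMr ?addr_gt0 //; nra.
Qed.

End Phi.

(** * Extremal integers *)

Lemma int_has_max (Q : int -> Prop) (b : int) :
  (exists j, Q j) -> (forall j, Q j -> j <= b) ->
  exists2 m, Q m & forall j, Q j -> j <= m.
Proof.
move=> [a Qa] Qb.
have exP : exists n, `[< Q (a + n%:Z) >] by exists 0%N; apply/asboolP; rewrite addr0.
have leP n : `[< Q (a + n%:Z) >] -> (n <= `|b - a|)%N.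
  by move=> /asboolP/Qb; lia.
case: (ex_maxnP exP leP) => n /asboolP Qn nmax; exists (a + n%:Z) => // j Qj.
rewrite leNgt; apply/negP => nj.
have /nmax : `[< Q (a + `|j - a|%N%:Z) >].
  by apply/asboolP; have -> : a + `|j - a|%N%:Z = j by lia.
lia.
Qed.

Lemma int_has_min (Q : int -> Prop) (b : int) :
  (exists j, Q j) -> (forall j, Q j -> b <= j) ->
  exists2 m, Q m & forall j, Q j -> m <= j.
Proof.
move=> [a Qa] Qb.
case: (@int_has_max (fun j => Q (- j)) (- b)); first by exists (- a); rewrite opprK.
  by move=> j /Qb; lia.
move=> m Qm mmax; exists (- m) => // j Qj.
by have := mmax (- j); rewrite opprK => /(_ Qj); lia.
Qed.

Lemma int_bound_finite (I : finType) (Q : I -> int -> Prop) :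
  (forall i, exists l, forall j, l <= j -> Q i j) ->
  exists l, forall i j, l <= j -> Q i j.
Proof.
move=> /choice[l hl]; exists (\max_i absz (l i))%:Z => i j lj; apply: hl.
have := @leq_bigmax _ (fun i => absz (l i)) i; lia.
Qed.

(** * Levels on the finite set T *)

Section Levels.
Context {R : realType}.
Variables (C0 : R) (U : nat -> R -> R) (r : R) (T : {fset (nat -> R)}).
Hypothesis regU : regular_tails C0 U.
Hypothesis r4 : 4 <= r.
Hypothesis T_ell2 : forall t, t \in T -> ell2 t.

Let r_gt0 : 0 < r. Proof. by apply: lt_le_trans r4. Qed.
Let r_ge1 : 1 <= r. Proof. by apply: le_trans r4; rewrite ler1n. Qed.

Local Notation phiT := (@phiT R U r T).

Lemma phiT_le1 : exists l, forall j (x y : T), j <= l -> (phiT j x y <= 1%:E)%E.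
Proof.
case: (@int_bound_finite (T * T)%type (fun p j => (phiT (- j) p.1 p.2 <= 1%:E)%E)).
  move=> [x y] /=; have [l hl] := phi_le1 regU r4 (T_ell2 (fsvalP x)) (T_ell2 (fsvalP y)).
  by exists (- l) => j lj; apply: hl; lia.
move=> l hl; exists (- l) => j x y jl; have := hl (x, y) (- j).
by rewrite opprK; apply; lia.
Qed.

Lemma phiT_gt c : 0 < c ->
  exists l, forall j (x y : T), x != y -> l <= j -> (c%:E < phiT j x y)%E.
Proof.
move=> c0.
case: (@int_bound_finite (T * T)%type (fun p j => p.1 != p.2 -> (c%:E < phiT j p.1 p.2)%E)).
  move=> [x y] /=; have [->|xy] := eqVneq x y; first by exists 0.
  have : val x <> val y by move=> /val_inj/eqP; rewrite (negbTE xy).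
  by move=> /(phi_gt regU r4 c0)[l hl]; exists l => j lj _; exact: hl.
by move=> l hl; exists l => j x y xy lj; exact: (hl (x, y)).
Qed.

Hypothesis T_ge2 : (2 <= #|` T|)%N.

Lemma card_fsetT : #|{: T}| = #|` T|.
Proof. by rewrite cardfE. Qed.

Lemma exists_neq : exists x y : T, x != y.
Proof.
have /card_gt1P[x [y [_ _ xy]]] : (1 < #|[set: T]|)%N by rewrite cardsT card_fsetT.
by exists x, y.
Qed.

Lemma jlevel_max n (A : {set T}) m :
  (forall x y, x \in A -> y \in A -> (phiT m x y <= (2 ^+ n)%:E)%E) ->
  (forall j, (forall x y, x \in A -> y \in A -> (phiT j x y <= (2 ^+ n)%:E)%E) -> j <= m) ->
  jlevel U r n A = (m%:~R : R)%:E.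
Proof.
move=> hm max; apply/eqP; rewrite eq_le; apply/andP; split; last first.
  by apply: ereal_sup_ubound; exists m.
by apply: ge_ereal_sup => _ [j hj <-]; rewrite lee_fin ler_int; exact: max.
Qed.

(** Small levels qualify by [phiT_le1], and large ones fail by [phiT_gt] since [T] has two distinct
    points. So the supremum is a maximum and the default value of [xget] is never taken. *)
Lemma j0P : jlevel U r 0 [set: T] = ((j0 U r T)%:~R : R)%:E /\
  forall x y, (phiT (j0 U r T) x y <= 1%:E)%E.
Proof.
have [l1 h1] := phiT_le1; have [l2 h2] := phiT_gt (@ltr01 R).
have [x0 [y0 xy0]] := exists_neq.
case: (@int_has_max (fun j => forall x y, (phiT j x y <= 1%:E)%E) l2).
- by exists l1 => x y; exact: h1.
- move=> j hj; rewrite leNgt; apply/negP => lj.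
  by have := h2 j _ _ xy0 (ltW lj); rewrite ltNge hj.
move=> m hm max.
have E : jlevel U r 0 [set: T] = (m%:~R : R)%:E.
  apply: jlevel_max => [x y _ _|j hj]; first by rewrite expr0.
  by apply: max => x y; have := hj x y; rewrite !inE expr0; apply.
have -> : j0 U r T = m; last by [].
rewrite /j0; case: xgetP => [j _ /=|/(_ m)]; last by rewrite /= E.
by rewrite E => -[/eqP]; rewrite eqr_int => /eqP.
Qed.

Lemma jT_gt (x y : T) : x != y -> ((2 ^+ nT T)%:E < phiT (jT U r T) x y)%E.
Proof.
have c0 : 0 < (2 : R) ^+ nT T by rewrite exprn_gt0.
have [l1 h1] := phiT_le1; have [l2 h2] := phiT_gt c0.
have [x0 [y0 xy0]] := exists_neq.
pose sep j := forall x y : T, x != y -> ((2 ^+ nT T)%:E < phiT j x y)%E.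
case: (@int_has_min sep l1).
- by exists l2 => x' y' xy'; exact: h2.
- move=> j hj; rewrite leNgt; apply/negP => jl.
  have := hj _ _ xy0; rewrite ltNge; apply/negP; rewrite negbK.
  apply: (le_trans (h1 _ _ _ (ltW jl))).
  by rewrite lee_fin exprn_ege1 // ler1n.
move=> m hm min; rewrite /jT; case: xgetP => [j _ [hj _] /hj //|/(_ m)].
by case; split.
Qed.

Lemma rpowN_jlevel_le n (A : {set T}) j :
  (forall x y, x \in A -> y \in A -> (phiT j x y <= (2 ^+ n)%:E)%E) ->
  (rpowN r (jlevel U r n A) <= (r ^ (- j))%:E)%E.
Proof.
move=> hj.
have : ((j%:~R : R)%:E <= jlevel U r n A)%E by apply: ereal_sup_ubound; exists j.
case: (jlevel U r n A) => [z| |] //=; rewrite ?lee_fin => jz; last first.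
  by rewrite exprz_ge0 // ltW.
by rewrite -(powR_intmul (- j) (ltW r_gt0)) mulrNz ler_powR ?lerN2.
Qed.

Lemma rpowN_jlevel_set1 n (x : T) : rpowN r (jlevel U r n [set x]) = 0%E.
Proof.
have -> : jlevel U r n [set x] = +oo%E; last by [].
apply: eq_infty => M.
have [j Mj] : exists j : int, M <= j%:~R.
  by exists (Num.ceil M); rewrite ceil_ge.
apply: (@le_trans _ _ (j%:~R : R)%:E); first by rewrite lee_fin.
apply: ereal_sup_ubound; exists j => // y z /set1P -> /set1P ->.
by apply: (phi_xx regU r4); rewrite exprn_gt0.
Qed.

Lemma rpowN_ge0 z : (0 <= rpowN r z)%E.
Proof. by case: z => [z| |] //=; rewrite lee_fin powR_ge0. Qed.

End Levels.

(** * The greedy family *)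

Lemma ratio_ge4 (R : realType) kappa : (5 <= kappa)%N -> 4 <= (2 : R) ^+ (kappa - 3).
Proof.
move=> kappa5; rewrite (_ : (kappa - 3 = (kappa - 5) + 2)%N); last by lia.
rewrite exprD (_ : 2 ^+ 2 = 4); last by rewrite -natrX.
by rewrite ler_peMl // exprn_ege1 // ler1n.
Qed.

Lemma ratio8 (R : realType) kappa : (5 <= kappa)%N -> 8 * 2 ^+ (kappa - 3) = (2 : R) ^+ kappa.
Proof.
move=> kappa5; rewrite [in RHS](_ : (kappa = 3 + (kappa - 3))%N); last by lia.
by rewrite exprD; congr (_ * _); rewrite -natrX.
Qed.

Section Family.
Context {R : realType}.
Variables (C0 : R) (U : nat -> R -> R) (rho : R) (T : {fset (nat -> R)}).
Variables (kappa sigma : nat) (f : nat -> int -> T -> R).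
Let r : R := 2 ^+ (kappa - 3).
Hypothesis gf : greedy_family U r kappa sigma f.

Local Notation phiT := (@phiT R U r T).
Local Notation j0 := (j0 U r T).
Local Notation jT := (jT U r T).
Local Notation nT := (nT T).

Lemma zero_rangeN n (j : int) : j0 - sigma%:Z - 2 <= j -> ~ zero_range U r T kappa sigma n j ->
  (n <= nT + kappa)%N /\ j < jT + sigma%:Z + 3.
Proof. by rewrite /zero_range => hj /not_orP[/not_andP h1 h2]; lia. Qed.

(** The zero range is stable under both moves, so there the inequalities read [0 <= 0]; elsewhere
    they come from the maximum in the recursion. *)
Lemma family_step n (j : int) u : j0 - sigma%:Z - 2 <= j ->
  f (n + kappa) (j + 1) u <= f n j u /\ f n (j + 1) u <= f n j u.
Proof.
move=> hj; have [z|nz] := pselect (zero_range U r T kappa sigma n j).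
  have z1 : zero_range U r T kappa sigma n (j + 1).
    by move: z; rewrite /zero_range; lia.
  have z2 : zero_range U r T kappa sigma (n + kappa) (j + 1).
    by move: z; rewrite /zero_range; lia.
  by rewrite !(gf_zero gf).
have [hn hj'] := zero_rangeN hj nz.
have [a _ ->] := gf_step gf u nz hn hj (ltW hj').
by rewrite !le_max !lexx !orbT.
Qed.

(** Induction on the distance to level [jT + sigma + 3], from which on [f] vanishes, using that
    [f n] decreases with the level. *)
Lemma family_ge0 n (j : int) u : j0 - sigma%:Z - 2 <= j -> 0 <= f n j u.
Proof.
move=> hj; have [N] : exists N, (absz (jT + sigma%:Z + 3 - j)%R <= N)%N
  by exists (absz (jT + sigma%:Z + 3 - j)%R).
elim: N j hj => [|N IH] j hj hN.
  by rewrite (gf_zero gf) //; right; lia.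
have [z|] := lerP (jT + sigma%:Z + 3) j; first by rewrite (gf_zero gf) //; right.
move=> hj'; apply: le_trans (family_step n u hj).2.
by apply: IH; lia.
Qed.

Lemma family_le n m (j l : int) p u : j0 - sigma%:Z - 2 <= j ->
  m = (n + p * kappa)%N -> j + p%:Z <= l -> f m l u <= f n j u.
Proof.
elim: p n j => [|p IH] n j hj.
  rewrite mul0n addn0 addr0 => -> jl.
  have [q ->] : exists q : nat, l = j + q%:Z by exists (absz (l - j)); lia.
  elim: q => [|q IHq]; first by rewrite addr0.
  apply: le_trans IHq; rewrite (_ : j + q.+1%:Z = j + q%:Z + 1); last by lia.
  by apply: (family_step _ _ _).2; lia.
move=> mE jl; apply: le_trans (family_step n u hj).1.
apply: IH; [lia| |lia].
by rewrite mE mulSn addnA.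
Qed.

(* The labels below [Ncard (n + kappa) - 1] are the greedy points, the last one
   marks the leftover piece, and [lab] is arbitrary outside the ball. *)
Definition greedy_splitting n (j : int) u (lab : T -> nat) : Prop :=
  (forall x y, x \in rball U r (j + 1) u (2 ^+ n) ->
      y \in rball U r (j + 1) u (2 ^+ n) ->
      lab x = lab y -> lab x != (Ncard (n + kappa)).-1 ->
      (phiT (j + sigma%:Z + 2) x y <= (2 ^+ n)%:E)%E) /\
  (forall x, x \in rball U r (j + 1) u (2 ^+ n) ->
      lab x = (Ncard (n + kappa)).-1 ->
      f (n + kappa) (j + sigma%:Z + 3) x + 2 ^+ n * r ^ (- j - sigma%:Z - 1)
        <= f n j u).

Hypothesis kappa5 : (5 <= kappa)%N.
Hypothesis regU : regular_tails C0 U.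
Hypothesis rhoP : 0 < rho < 10^-1.
Hypothesis BsetM : forall u : R, 0 < u ->
  (Bset U (8 * r * u) `<=` dilate (rho * r) (Bset U u))%classic.
Hypothesis T_ell2 : forall t, t \in T -> ell2 t.
Hypothesis T_ge2 : (2 <= #|` T|)%N.

Let r4 : 4 <= r := ratio_ge4 R kappa5.

(** The first [N - 1] greedy points label the points near them. If the run is completed, the [N]-th
    point maximizes [f (n + kappa) (j + sigma + 3)] on the leftover, so [A_{n,j}(u) <= f n j u]
    yields the drop for every leftover point. If the run stops early, nothing is left over. *)
Lemma greedy_split n (j : int) u : (n <= nT)%N -> j0 - sigma%:Z - 2 <= j ->
  exists2 lab : T -> nat,
    forall x, (lab x < Ncard (n + kappa))%N & greedy_splitting n j u lab.
Proof.
move=> hn hj.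
have c0 : 0 < (2 : R) ^+ n by rewrite exprn_gt0.
have N2 : (1 < Ncard (n + kappa))%N.
  rewrite /Ncard; case: eqP => [|_]; first by move: kappa5; lia.
  by rewrite -[X in (X < _)%N](expn0 2) ltn_exp2l // expn_gt0.
(* Above [jT + sigma + 3] the ball reduces to its centre [u], since distinct points are more than
   [2^nT] apart at level [jT]. The constant label 0 works there because [N >= 2] keeps it different
   from the leftover label. *)
have [hjT|hjT] := lerP (jT + sigma%:Z + 3) j.
  have one x : x \in rball U r (j + 1) u (2 ^+ n) -> x = u.
    rewrite inE => xu; apply/eqP; rewrite eq_sym; apply: contraT => ux.
    have := jT_gt regU r4 T_ell2 T_ge2 ux; rewrite ltNge; apply: contraNT => _.
    have := @phi_le_trans _ _ _ r regU r4 jT (j + 1) (val u) (val x) (2 ^+ n) c0.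
    move=> /(_ _ xu) h; apply: le_trans (h _) _; first by lia.
    by rewrite lee_fin ler_eXn2l // ltr1n.
  exists (fun=> 0%N) => [x|]; first exact: ltnW.
  split => [x y /one -> /one -> _ _|x _]; first exact: (phi_xx regU r4).
  by move: N2; case: (Ncard _) => [|[]].
have nz : ~ zero_range U r T kappa sigma n j by rewrite /zero_range; lia.
have [a [xs [run val_a]] fE] := gf_step gf u nz (leq_trans hn (leq_addr _ _)) hj (ltW hjT).
rewrite /greedy_splitting; set N := Ncard (n + kappa) in N2 val_a *.
pose near (x xi : T) := x \in dball U r (j + sigma%:Z + 3) xi (2 ^+ (n + kappa)).
(* The label is the index of the first greedy ball containing [x]. In a completed run [find] returns
   [N.-1] when there is none, which is the leftover label. *)
pose lab (x : T) := find (near x) (take N.-1 xs).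
have lab_le x : (lab x <= N.-1)%N.
  by apply: (leq_trans (find_size _ _)); rewrite size_take; case: ltnP => //; lia.
have in_rem x (ys : seq T) : x \in rball U r (j + 1) u (2 ^+ n) ->
    ~~ has (near x) ys -> x \in remaining U r kappa sigma n j u ys.
  move=> xu /hasPn hx; rewrite inE xu andbT; apply/bigcupP => -[y /hx /negP]; exact.
have big x : x \in rball U r (j + 1) u (2 ^+ n) -> ~~ has (near x) (take N.-1 xs) ->
    f (n + kappa) (j + sigma%:Z + 3) x + 2 ^+ n * r ^ (- j - sigma%:Z - 1) <= f n j u.
  move=> xu hx; case: val_a => [[sz rem0 _]|[sz aE]].
    have := in_rem x xs xu; rewrite rem0 inE.
    by move: hx; rewrite take_oversize => [-> /(_ isT)//|]; lia.
  rewrite fE le_max le_max aE [X in _ || (X || _)](_ : _ = true) ?orbT //.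
  rewrite addrC lerD2l; have lt : (N.-1 < size xs)%N by lia.
  have [_ /(_ x)] := run _ lt; rewrite -nth_last sz.
  by apply; exact: in_rem.
exists lab => [x|]; first by move: (lab_le x); lia.
split => [x y xu yu e ne|x xu e].
- have hasx z : lab z != N.-1 -> z \in rball U r (j + 1) u (2 ^+ n) -> has (near z) (take N.-1 xs).
    move=> ne' zu; apply: contraT => hz; case: val_a => [[sz rem0 _]|[sz aE]].
      have := in_rem z xs zu; rewrite rem0 inE.
      by move: hz; rewrite take_oversize => [-> /(_ isT)//|]; lia.
    move: ne'; rewrite /lab hasNfind // size_take; case: ltnP; rewrite ?eqxx //; lia.
  have hx := hasx _ ne xu; have hy := hasx y; rewrite -e in hy; have {}hy := hy ne yu.
  have := nth_find u hx; have := nth_find u hy; rewrite -/(lab x) -/(lab y) -e /near !inE.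
  (* The radius [2^(n + kappa) = 8 r 2^n] is the one that [phi_dilate] brings back to [2^n] at the
     cost of one level. *)
  rewrite (_ : j + sigma%:Z + 3 = j + sigma%:Z + 2 + 1); last by lia.
  rewrite exprD -(ratio8 R kappa5) mulrC => hy' hx'.
  exact: (phi_dilate regU r4 rhoP BsetM c0 hx' hy').
- apply: big => //; apply/negP; rewrite has_find -/(lab x) e size_take; case: ifP; lia.
Qed.

(** One labelling is chosen for each state; outside the range of [greedy_split] it is constantly 0,
    so that the bound on the number of labels holds everywhere. *)
Lemma greedy_labels : exists2 L : nat -> int -> T -> T -> nat,
  forall k j u x, (L k j u x < Ncard (k * kappa + kappa))%N &
  forall k (j : int) u, (k * kappa <= nT)%N -> j0 - sigma%:Z - 2 <= j ->
    greedy_splitting (k * kappa) j u (L k j u).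
Proof.
have /choice[L HL] : forall p : nat * int * T, exists lab : T -> nat,
    (forall x, (lab x < Ncard (p.1.1 * kappa + kappa))%N) /\
    ((p.1.1 * kappa <= nT)%N -> j0 - sigma%:Z - 2 <= p.1.2 ->
      greedy_splitting (p.1.1 * kappa) p.1.2 p.2 lab).
  move=> [[k j] u] /=.
  have [/andP[hk hj]|h] := boolP ((k * kappa <= nT)%N && (j0 - sigma%:Z - 2 <= j)).
    by have [lab h1 h2] := greedy_split u hk hj; exists lab.
  exists (fun=> 0%N); split=> [_|hk hj]; last by move: h; rewrite hk hj.
  by rewrite /Ncard; case: ifP => // _; rewrite expn_gt0.
exists (fun k j u => L (k, j, u)) => k j u; first exact: (HL (k, j, u)).1.
exact: (HL (k, j, u)).2.
Qed.

End Family.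

(** * The chain of partitions *)

(** [g'] factors through the pair of [g] and [h]; [F] below is the factorization, read off a chosen
    preimage. *)
Lemma card_imset_le_mul (T S1 S2 : finType) (M : nat) (g : T -> S1) (g' : T -> S2) (h : T -> nat) :
  (forall x, h x < M)%N ->
  (forall x y, g x = g y -> h x = h y -> g' x = g' y) ->
  (#|g' @: [set: T]| <= #|g @: [set: T]| * M)%N.
Proof.
move=> hM gg'; pose q x := (g x, Ordinal (hM x)).
have [x0|T0] := pickP (@predT T); last first.
  by rewrite (_ : [set: T] = finset.set0) ?imset0 ?cards0 //; apply/setP => x; have := T0 x.
move=> _; pose F p := g' (odflt x0 [pick x | q x == p]).
have -> : g' @: [set: T] = F @: (q @: [set: T]).
  rewrite -imset_comp; apply: eq_imset => x /=; rewrite /F.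
  case: pickP => [y /eqP[gE hE]|/(_ x)]; last by rewrite eqxx.
  by apply: gg'.
apply: (leq_trans (leq_imset_card _ _)).
rewrite -[M in leqRHS]card_ord -cardsT -cardsX; apply: subset_leq_card.
by apply/fintype.subsetP => _ /imsetP[x _ ->]; rewrite finset.in_setX finset.in_setT andbT;
  apply/imsetP; exists x.
Qed.

Lemma card_preim_partition_le (T S : finType) (g : T -> S) :
  (#|preim_partition g [set: T]| <= #|g @: [set: T]|)%N.
Proof.
have -> : preim_partition g [set: T] =
    (fun v => [set y in [set: T] | v == g y]) @: (g @: [set: T]).
  by rewrite -imset_comp.
exact: leq_imset_card.
Qed.

Lemma pblock_preim (T S : finType) (g : T -> S) t :
  finset.pblock (preim_partition g [set: T]) t = [set x | g x == g t].
Proof.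
apply/setP => x; rewrite inE.
have eqR : {in [set: T] & &, equivalence_rel [rel x y | g x == g y]}.
  by move=> a b c _ _ _; split=> /= [|/eqP ->].
by rewrite (pblock_equivalence_partition eqR) ?inE //= eq_sym.
Qed.

Lemma preim_partition_refines (T S1 S2 : finType) (g : T -> S1) (g' : T -> S2) B :
  (forall x y, g' x = g' y -> g x = g y) ->
  B \in preim_partition g' [set: T] ->
  exists2 C, C \in preim_partition g [set: T] & B \subset C.
Proof.
move=> gg' /imsetP[x _ ->]; exists [set y in [set: T] | g x == g y].
  exact: imset_f.
by apply/fintype.subsetP => y; rewrite !inE /= => /eqP/gg' ->.
Qed.

Section Chain.
Variables (T : finType) (s : nat) (N : nat -> nat).
Variables (L : nat -> int -> T -> T -> nat) (jini : int) (uini : T).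
Hypothesis L_lt : forall k j u x, (L k j u x < N k)%N.

(* The state (cell, level j, anchor u) of [t] at step [k]; in the application the
   cell lies in the ball B_{j+1}(u, 2^(k kappa)).  Label [(N k).-1] marks the
   leftover piece, which alone may fail to contain its anchor. *)
Fixpoint chain k t : {set T} * int * T :=
  if k is k'.+1 then
    let: (A, j, u) := chain k' t in
    let A' := [set x in A | L k' j u x == L k' j u t] in
    if L k' j u t == (N k').-1 then (A', j, u)
    else (A', j + s%:Z, odflt t [pick x in A'])
  else ([set: T], jini, uini).

Definition cell k t := (chain k t).1.1.
Definition level k t := (chain k t).1.2.
Definition anchor k t := (chain k t).2.
Definition label k t x := L k (level k t) (anchor k t) x.
Definition large k t := label k t t == (N k).-1.

Lemma chainS k t : chain k.+1 t =
  let A' := [set x in cell k t | label k t x == label k t t] in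
  if large k t then (A', level k t, anchor k t)
  else (A', level k t + s%:Z, odflt t [pick x in A']).
Proof. by rewrite /large /label /cell /level /anchor /=; case: (chain k t) => [[]]. Qed.

Lemma cellS k t : cell k.+1 t = [set x in cell k t | label k t x == label k t t].
Proof. by rewrite {1}/cell chainS /=; case: ifP. Qed.

Lemma levelS k t : level k.+1 t = if large k t then level k t else level k t + s%:Z.
Proof. by rewrite {1}/level chainS /=; case: ifP. Qed.

Lemma cell_refl k t : t \in cell k t.
Proof. by elim: k => [|k IH]; rewrite ?inE // cellS inE IH eqxx. Qed.

Lemma cell_sub k l t : (k <= l)%N -> cell l t \subset cell k t.
Proof.
move=> /subnKC <-; elim: (l - k)%N => [|p IH]; first by rewrite addn0.
rewrite addnS; apply: fintype.subset_trans IH; apply/fintype.subsetP => x.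
by rewrite cellS inE => /andP[].
Qed.

Lemma anchor_large k t : large k t -> anchor k.+1 t = anchor k t.
Proof. by move=> h; rewrite {1}/anchor chainS h. Qed.

Lemma anchor_small k t : ~~ large k t -> anchor k.+1 t \in cell k.+1 t.
Proof.
move=> /negbTE h; rewrite {1}/anchor chainS h /= -cellS.
by case: pickP => //= /(_ t); rewrite cell_refl.
Qed.

(** The level moves only at steps that also choose a new anchor in the current cell, so a changed
    level witnesses an anchor chosen after step [k]. *)
Lemma anchor_in k l t : (k <= l)%N -> level l t != level k t -> 0 < s%:Z :> int ->
  anchor l t \in cell k t.
Proof.
move=> + + s0; move=> /subnKC <-; elim: (l - k)%N => [|p IH]; first by rewrite addn0 eqxx.
rewrite addnS levelS; case: ifPn => [big|small] ne.
  by rewrite anchor_large //; exact: IH.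
by apply: (fintype.subsetP (cell_sub _ _) _ (anchor_small small)); rewrite leqW // leq_addr.
Qed.

(** The whole state depends on the point only through its cell, so the cells of one step form a
    partition. *)
Lemma chain_eq k t x : x \in cell k t -> chain k x = chain k t.
Proof.
elim: k => // k IH; rewrite cellS inE => /andP[/IH e /eqP lE].
have labE y : label k x y = label k t y by rewrite /label /level /anchor e.
have cE : cell k.+1 x = cell k.+1 t.
  by rewrite !cellS /cell e; apply/setP => y; rewrite !inE !labE lE.
rewrite !chainS /large -!cellS cE labE lE /level /anchor e.
case: ifP => // _; congr (_, _).
by case: pickP => //= /(_ t); rewrite cell_refl.
Qed.

Lemma cell_eq k t x : (x \in cell k t) = (cell k x == cell k t).
Proof.
apply/idP/eqP => [/chain_eq|<-]; last exact: cell_refl.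
by rewrite /cell => ->.
Qed.

Lemma cell_eqW k l x y : (k <= l)%N -> cell l x = cell l y -> cell k x = cell k y.
Proof.
move=> kl e; apply/eqP; rewrite -cell_eq; apply: (fintype.subsetP (cell_sub _ kl)).
by rewrite cell_eq e.
Qed.

Lemma card_cell_le k : (#|cell k @: [set: T]| <= \prod_(0 <= i < k) N i)%N.
Proof.
elim: k => [|k IH].
  rewrite big_geq // -[1%N](cards1 [set: T]); apply: subset_leq_card.
  by apply/fintype.subsetP => _ /imsetP[x _ ->]; rewrite inE.
rewrite big_nat_recr //=; apply: (@leq_trans (#|cell k @: [set: T]| * N k)).
  apply: (@card_imset_le_mul _ _ _ _ _ _ (fun x => label k x x)) => [x|x y cE lE].
    exact: L_lt.
  have /chain_eq e : x \in cell k y by rewrite cell_eq cE.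
  apply/eqP; rewrite -cell_eq cellS inE cell_eq cE eqxx /=.
  by rewrite -lE /label /level /anchor e.
by rewrite leq_mul2r IH orbT.
Qed.

End Chain.

(** Induction: [k kappa + 1 <= (k + 1) kappa], so both factors are at most [2^(2^((k + 1) kappa))],
    and their product only doubles the exponent. *)
Lemma prod_Ncard_le kappa k : (0 < kappa)%N ->
  (\prod_(0 <= i < k) Ncard (i * kappa + kappa) <= Ncard (k * kappa).+1)%N.
Proof.
move=> kappa0; elim: k => [|k IH]; first by rewrite big_geq.
rewrite big_nat_recr //=; apply: (leq_trans (leq_mul IH (leqnn _))).
rewrite addnC -mulSn /Ncard (_ : (k.+1 * kappa == 0)%N = false); last first.
  by rewrite muln_eq0; lia.
rewrite /= -expnD leq_exp2l // [X in (_ <= X)%N]expnS mul2n -addnn leq_add2r.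
by rewrite leq_exp2l // mulSn; lia.
Qed.

Lemma Ncard_le m n : (m <= n)%N -> (Ncard m <= Ncard n)%N.
Proof.
rewrite /Ncard; case: eqP => [_|m0] mn.
  by case: ifP => // _; rewrite expn_gt0.
by rewrite (_ : (n == 0)%N = false); [rewrite !leq_exp2l | lia].
Qed.

(** * The chain driven by the greedy family *)

Section ChainOfFamily.
Context {R : realType}.
Variables (C0 : R) (U : nat -> R -> R) (T : {fset (nat -> R)}).
Variables (kappa sigma : nat) (f : nat -> int -> T -> R).
Hypothesis kappa5 : (5 <= kappa)%N.
Let r : R := 2 ^+ (kappa - 3).
Hypothesis regU : regular_tails C0 U.
Hypothesis T_ell2 : forall t, t \in T -> ell2 t.
Hypothesis T_ge2 : (2 <= #|` T|)%N.
Hypothesis gf : greedy_family U r kappa sigma f.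
Hypothesis sigma2 : (2 <= sigma)%N.

Local Notation phiT := (@phiT R U r T).
Local Notation j0 := (j0 U r T).
Local Notation nT := (nT T).
Local Notation N := (fun k => Ncard (k * kappa + kappa)).

Let r4 : 4 <= r := ratio_ge4 R kappa5.
Let r8 : 8 * r = 2 ^+ kappa := ratio8 R kappa5.
Let r_gt0 : 0 < r. Proof. by apply: lt_le_trans r4. Qed.
Let r_ge1 : 1 <= r. Proof. by apply: le_trans r4; rewrite ler1n. Qed.
Let pow2_gt0 n : 0 < (2 : R) ^+ n. Proof. by rewrite exprn_gt0. Qed.

Variables (L : nat -> int -> T -> T -> nat) (u0 : T).
Hypothesis L_lt : forall k j u x, (L k j u x < N k)%N.
Hypothesis L_split : forall k (j : int) u,
  (k * kappa <= nT)%N -> j0 - sigma%:Z - 2 <= j ->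
  greedy_splitting U kappa sigma f (k * kappa) j u (L k j u).

Local Notation cell := (cell sigma.+1 N L (j0 - 1) u0).
Local Notation level := (level sigma.+1 N L (j0 - 1) u0).
Local Notation anchor := (anchor sigma.+1 N L (j0 - 1) u0).
Local Notation large := (large sigma.+1 N L (j0 - 1) u0).

Lemma level_ge k t : j0 - sigma%:Z - 2 <= level k t.
Proof.
elim: k => [|k IH]; first by rewrite /level /=; clear; lia.
by rewrite levelS; case: ifP => // _; apply: le_trans IH _; rewrite lerDl.
Qed.

(** Starting at level [j0 - 1], the first ball is B_{j0}(u0, 1), which is all of [T]. A leftover
    step only enlarges the radius. At the other steps, equally labelled points are close at level
    [j + sigma + 2], one above the new level [j + sigma + 1], so the ball around the new anchor
    contains the cell. *)
Lemma cell_in_ball k t x : (k * kappa <= nT)%N -> x \in cell k t ->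
  x \in rball U r (level k t + 1) (anchor k t) (2 ^+ (k * kappa)).
Proof.
elim: k x => [|k IH] x hk xk.
  have [_ h] := j0P regU r4 T_ell2 T_ge2.
  by rewrite inE mul0n expr0 [level _ _ + 1](_ : _ = j0) ?h // /level /=; lia.
have hk' : (k * kappa <= nT)%N by apply: leq_trans hk; rewrite leq_mul2r leqnSn orbT.
have grow : (2 : R) ^+ (k * kappa) <= 2 ^+ (k.+1 * kappa).
  by rewrite ler_eXn2l ?ltr1n // mulSn leq_addl.
have xk' : x \in cell k t by apply: (fintype.subsetP (cell_sub _ _ _ _ _ _ (leqnSn k))).
have bx := IH _ hk' xk'.
have [big|small] := boolP (large k t).
  rewrite levelS big anchor_large //; move: bx; rewrite !inE => /le_trans; apply.
  by rewrite lee_fin.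
rewrite levelS (negbTE small).
have cl := anchor_small small.
have bc := IH _ hk' (fintype.subsetP (cell_sub _ _ _ _ _ _ (leqnSn k)) _ cl).
move: cl xk; rewrite !cellS !inE => /andP[_ /eqP lc] /andP[_ /eqP lx].
have hl := level_ge k t.
have h := (L_split _ hk' hl).1 _ _ bc bx (etrans lc (esym lx)).
rewrite (_ : level k t + sigma.+1%:Z + 1 = level k t + sigma%:Z + 2); last by clear; lia.
apply: (le_trans (h _)); last by rewrite lee_fin.
by rewrite [L _ _ _ _]lc.
Qed.

Definition weight t k : R := 2 ^+ (k * kappa) * r ^ (- level k t).

Lemma weight_ge0 t k : 0 <= weight t k.
Proof. by rewrite mulr_ge0 ?(ltW (pow2_gt0 _)) // exprz_ge0 // ltW. Qed.

Lemma weightE t k : weight t k = 8 ^+ k * r ^ (- (level k t - k%:Z)).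
Proof.
rewrite /weight mulnC exprM -r8 exprMn -mulrA; congr (_ * _).
by rewrite opprB expfzDr ?gt_eqF.
Qed.

Lemma weight0 t : weight t 0 = r * r ^ (- j0).
Proof.
rewrite /weight mul0n expr0 mul1r [level _ _]/= opprB expfzDr ?gt_eqF //.
Qed.

(** Off the leftover steps the ratio is at most [8 r r^(-sigma - 1) = 8 / r^sigma], hence at most
    1/2 as [r >= 4] and [sigma >= 2]. *)
Lemma weightS t k : weight t k.+1 <=
  if large k t then 2 ^+ kappa * weight t k else 2^-1 * weight t k.
Proof.
rewrite /weight levelS mulSn exprD.
case: ifP => _; first by rewrite mulrA.
rewrite opprD expfzDr ?gt_eqF // -r8.
set A := 2 ^+ (k * kappa); set X := r ^ (- level k t); set Y := r ^ _.
have -> : 8 * r * A * (X * Y) = (8 * r * Y) * (A * X) by ring.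
apply: ler_wpM2r; first by rewrite mulr_ge0 ?exprz_ge0 ?(ltW r_gt0) ?(ltW (pow2_gt0 _)).
have rs : 0 < r ^+ sigma by rewrite exprn_gt0.
have -> : 8 * r * Y = 8 / r ^+ sigma.
  rewrite /Y -exprnN exprS; field; rewrite expf_neq0 ?gt_eqF //=.
rewrite ler_pdivrMr //.
have : 4 ^+ 2 <= r ^+ sigma.
  apply: (@le_trans _ _ (r ^+ 2)); last by rewrite ler_weXn2l.
  by rewrite lerXn2r ?nnegrE // ltW.
rewrite (_ : 4 ^+ 2 = 16) -?natrX //; lra.
Qed.

Variables (F : R).
Hypothesis fF : forall n j u, f n j u <= F.

Let K := (nT %/ kappa).+1.

Lemma index_le k : (k < K)%N -> (k * kappa <= nT)%N.
Proof.
rewrite ltnS => kK; apply: leq_trans (leq_trunc_div nT kappa).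
by rewrite leq_mul2r kK orbT.
Qed.

Lemma sum_weight_le t :
  \sum_(0 <= k < K) weight t k <=
  2 * r * r ^ (- j0) + 4 * 2 ^+ kappa * r ^+ sigma.+1 * sigma.+2%:R * F.
Proof.
have hj0 : j0 - sigma%:Z - 2 <= j0 by clear; lia.
have F0 : 0 <= F by apply: le_trans (fF 0 j0 t); exact: (family_ge0 gf _ _ hj0).
have rs : 0 < r ^+ sigma.+1 by rewrite exprn_gt0.
have wE : 2 * r * r ^ (- j0) = 2 * weight t 0 by rewrite weight0 mulrA.
apply: le_trans (sum_le_of_steps K (weight_ge0 t) (ltW (pow2_gt0 kappa)) (weightS t)) _.
rewrite wE lerD2l.
suff H : (r ^+ sigma.+1)^-1 * \sum_(0 <= k < K | large k t) weight t k <= 2 * sigma.+2%:R * F.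
  have H' : \sum_(0 <= k < K | large k t) weight t k <= r ^+ sigma.+1 * (2 * sigma.+2%:R * F).
    by rewrite -ler_pdivrMl.
  have -> : 4 * 2 ^+ kappa * r ^+ sigma.+1 * sigma.+2%:R * F =
    2 * 2 ^+ kappa * (r ^+ sigma.+1 * (2 * sigma.+2%:R * F)) by ring.
  by rewrite ler_pM2l // mulr_gt0.
have drop k : (r ^+ sigma.+1)^-1 * weight t k =
    2 ^+ (k * kappa) * r ^ (- level k t - sigma%:Z - 1).
  rewrite /weight mulrCA; congr (_ * _).
  by rewrite exprnN -expfzDr ?gt_eqF //; congr (r ^ _); clear; lia.
under eq_bigr do rewrite weightE.
(* The potential is the value of [f] at the current anchor. With [s = sigma.+1], the gap asked of
   [D] is [sigma + 2]. *)
apply: (@sum_marked_le _ K sigma.+1 (fun k => level k t - k%:Z) (fun k => large k t) r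
  (fun k => f (k * kappa) (level k t) (anchor k t)) _ F) => //.
- by rewrite invr_ge0 ltW.
- move=> k /index_le hk big; rewrite -weightE drop.
  have hl := level_ge k t.
  have := (L_split _ hk hl).2 _ (cell_in_ball hk (cell_refl _ _ _ _ _ _ _)) (eqP big).
  apply: le_trans; rewrite lerDr; apply: (family_ge0 gf).
  by apply: le_trans hl _; clear; lia.
move=> k l /andP[kl lK] big _ Dkl; rewrite -weightE drop.
have hk : (k * kappa <= nT)%N by apply: index_le; exact: ltn_trans lK.
have hl := level_ge k t.
have lev : level k.+1 t = level k t by rewrite levelS big.
(* Since the level has changed by step [l], the later anchor lies in the leftover piece cut at step
   [k], where the drop applies. *)
have cin : anchor l t \in cell k.+1 t.
  by apply: anchor_in => //; rewrite lev; apply/eqP => e; move: Dkl; rewrite e; clear -kl; lia.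
move: (cin); rewrite cellS inE => /andP[cin' /eqP lc].
have := (L_split _ hk hl).2 _ (cell_in_ball hk cin').
move=> /(_ (etrans lc (eqP big))); apply: le_trans.
have hl' : j0 - sigma%:Z - 2 <= level k t + sigma%:Z + 3 by clear -hl; lia.
(* The gap in [D] says exactly that [level l >= level k + sigma + 3 + (l - k - 1)]: one level for
   each of the [l - k - 1] moves from [(k + 1) kappa] to [l kappa]. *)
rewrite lerD2r; apply: (family_le gf (p := (l - k.+1)%N) _ hl'); last by clear -Dkl kl; lia.
by rewrite [(k * kappa + kappa)%N]addnC -mulSn -mulnDl subnKC.
Qed.

(** Step [k] has at most [Ncard (k kappa + 1)] cells, so it serves from [n = k kappa + 1] on, whence
    [n.-1]. From [nT] on singletons are allowed, and their terms vanish. *)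
Definition cell_at n t : {set T} := if (n < nT)%N then cell (n.-1 %/ kappa) t else [set t].

Let kappa_gt0 : (0 < kappa)%N. Proof. exact: leq_trans kappa5. Qed.

Lemma cell_at_admissible : admissible (fun n => preim_partition (cell_at n) [set: T]).
Proof.
move=> n; split=> [||B].
- exact: preim_partitionP.
- rewrite /cell_at; case: ltnP => nn.
    apply: (leq_trans (card_preim_partition_le _)); apply: (leq_trans (card_cell_le _ _ _ L_lt _)).
    case: n nn => [|n] _; first by rewrite div0n big_geq.
    apply: (leq_trans (prod_Ncard_le _ kappa_gt0)); apply: Ncard_le.
    by rewrite ltnS leq_trunc_div.
  apply: (leq_trans (card_preim_partition_le _)); apply: (leq_trans (leq_imset_card _ _)).
  rewrite cardsT card_fsetT; apply: leq_trans (Ncard_le nn).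
  by rewrite /Defs.nT; case: ex_minnP.
apply: preim_partition_refines => x y; rewrite /cell_at.
case: (ltnP n.+1) => [nn|_ /set1_inj -> //].
by rewrite (ltnW nn); apply: cell_eqW; apply: leq_div2r; exact: leq_pred.
Qed.

Lemma sum_cell_at_le t :
  (\sum_(n <oo) (2 ^+ n : R)%:E *
     rpowN r (jlevel U r n (finset.pblock (preim_partition (cell_at n) [set: T]) t))
   <= (r * r ^ (- j0) + kappa%:R * 2 ^+ kappa * \sum_(0 <= k < K) weight t k)%:E)%E.
Proof.
pose h n : \bar R := ((2 ^+ n)%:E *
  rpowN r (jlevel U r n (finset.pblock (preim_partition (cell_at n) [set: T]) t)))%E.
rewrite -[leLHS]/(\sum_(n <oo) h n)%E.
(* For [n = m + 1] and [k = m %/ kappa], one has [n <= (k + 1) kappa], whence the factor [2^kappa].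
   The term [n = 0] is the weight of step 0. *)
pose H n : R := if n is m.+1 then 2 ^+ kappa * weight t (m %/ kappa) else r * r ^ (- j0).
have rj0 : 0 <= r ^ (- j0) by rewrite exprz_ge0 // ltW.
have H0 n : 0 <= H n.
  by case: n => [|n] /=; rewrite mulr_ge0 ?weight_ge0 ?(ltW r_gt0) ?(ltW (pow2_gt0 _)).
have h0 n : (0 <= h n)%E by rewrite /h mule_ge0 ?rpowN_ge0 // lee_fin ltW.
have hz n : (nT <= n)%N -> h n = 0%E.
  move=> nn; rewrite /h pblock_preim /cell_at ltnNge nn /=.
  rewrite (_ : [set x | _] = [set t]) ?(rpowN_jlevel_set1 regU) ?mule0 //.
  by apply/setP => x; rewrite !inE; apply/eqP/eqP => [/set1_inj|->].
have hH n : (h n <= (H n)%:E)%E.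
  have [nn|/hz ->] := ltnP n nT; last by rewrite lee_fin.
  rewrite /h pblock_preim /cell_at nn; set k := (n.-1 %/ kappa)%N.
  have kn : (k * kappa <= n.-1)%N by exact: leq_trunc_div.
  have hkn : (k * kappa <= n)%N by exact: leq_trans kn (leq_pred n).
  have hk : (k * kappa <= nT)%N by exact: leq_trans hkn (ltnW nn).
  apply: (@le_trans _ _ (2 ^+ n * r ^ (- level k t))%:E).
    rewrite EFinM lee_wpmul2l ?lee_fin ?(ltW (pow2_gt0 _)) //.
    apply: rpowN_jlevel_le => // x y; rewrite !inE -!cell_eq => xk yk.
    have := cell_in_ball hk xk; have := cell_in_ball hk yk; rewrite !inE => hy hx.
    (* Two points of a ball at level [j + 1] are close at level [j], so the level of the chain is
       admissible in [jlevel]. *)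
    apply: le_trans (phi_quasi regU r4 (pow2_gt0 _) hx hy) _.
    by rewrite lee_fin ler_eXn2l ?ltr1n.
  rewrite lee_fin; case: n @k kn hkn hk nn => [|n] k kn hkn hk nn.
    by rewrite /H -(weight0 t) /weight /k div0n mul0n.
  rewrite /H -/k /weight mulrA -exprD; apply: ler_wpM2r; first by rewrite exprz_ge0 // ltW.
  rewrite ler_eXn2l ?ltr1n //= -mulSn.
  by have := ltn_ceil n kappa_gt0.
have nK : (nT <= K * kappa)%N by apply/ltnW/ltn_ceil.
rewrite (nneseries_split 0 (K * kappa).+1); last by move=> k _; exact: h0.
rewrite add0n [X in (_ + X)%E]eseries0 ?adde0; last first.
  by move=> i iK _; apply: hz; apply: leq_trans nK (ltnW iK).
apply: (@le_trans _ _ (\sum_(0 <= n < (K * kappa).+1) H n)%:E).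
  by rewrite -sumEFin; apply: lee_sum => n _; exact: hH.
rewrite lee_fin sum_blocks lerD2l mulr_sumr; apply: ler_sum => k _.
rewrite (eq_big_nat _ _ (F2 := fun=> 2 ^+ kappa * weight t k)) /=.
  by rewrite sumr_const_nat subn0 -[leLHS]mulr_natl mulrA.
by move=> i ik; rewrite divnMDl // divn_small // addn0.
Qed.

Lemma gammaT_le : (gammaT U r T <=
  (r * r ^ (- j0) + kappa%:R * 2 ^+ kappa *
    (2 * r * r ^ (- j0) + 4 * 2 ^+ kappa * r ^+ sigma.+1 * sigma.+2%:R * F))%:E)%E.
Proof.
apply: (@le_trans _ _ _ _ _ (ereal_inf_lbound _)); first exact: (imageP _ cell_at_admissible).
apply: ge_ereal_sup => _ [t _ <-]; apply: le_trans (sum_cell_at_le t) _.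
by rewrite lee_fin lerD2l ler_wpM2l ?sum_weight_le // mulr_ge0.
Qed.

End ChainOfFamily.

(** * The bound on gamma(T) *)

Theorem theorem6p3 (R : realType) (C0 : R) (kappa : nat) (kappa_ge5 : (5 <= kappa)%N) :
  exists sigma0 : nat, forall sigma : nat, (sigma0 <= sigma)%N ->
  exists C : R, 0 < C /\
  forall (d : measure_display) (Omega : measurableType d) (P : probability Omega R)
    (Y : nat -> {RV P >-> R}),
    independent Y ->
    (forall i, symmetric_rv (Y i)) ->
    let U := logtail Y in
    let r : R := 2 ^+ (kappa - 3) in
    regular_tails C0 U ->
    (exists2 rho : R, 0 < rho < 10^-1 &
      forall u : R, 0 < u ->
        (Bset U (8 * r * u) `<=` dilate (rho * r) (Bset U u))%classic) ->
  forall T : {fset (nat -> R)},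
    (forall t, t \in T -> ell2 t) ->
    (2 <= #|` T|)%N ->
  forall f : nat -> int -> T -> R,
    greedy_family U r kappa sigma f ->
    (gammaT U r T
     <= C%:E * (ereal_sup [set y | exists n j u, y = (f n j u)%:E]%classic
                + rpowN r (jlevel U r 0 [set: T])))%E.
Proof.
exists 2%N => sigma sigma2; pose r : R := 2 ^+ (kappa - 3).
have r4 : 4 <= r := ratio_ge4 R kappa_ge5.
have r0 : 0 < r by apply: lt_le_trans r4.
(* [C1] and [C2] are the coefficients of [r^(-j0)] and of the bound on [f] in [gammaT_le]. *)
pose C1 : R := r + kappa%:R * 2 ^+ kappa * (2 * r).
pose C2 : R := kappa%:R * 2 ^+ kappa * (4 * 2 ^+ kappa * r ^+ sigma.+1 * sigma.+2%:R).
have C1_gt0 : 0 < C1.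
  by rewrite ltr_pwDl // !mulr_ge0 ?exprn_ge0 ?ler0n // ltW.
have C2_ge0 : 0 <= C2 by rewrite /C2 !mulr_ge0 ?exprn_ge0 ?ler0n // ltW.
have C_gt0 : 0 < C1 + C2 by rewrite ltr_wpDr.
exists (C1 + C2); split=> // d Omega P Y _ _ U r1 regU [rho rhoP BsetM] T T_ell2 T_ge2 f gf.
have [E0 _] := j0P regU r4 T_ell2 T_ge2; rewrite -[r1]/r E0 /=.
rewrite -mulrNz powR_intmul ?(ltW r0) //.
have X_ge0 : 0 <= r ^ (- j0 U r T) by rewrite exprz_ge0 // ltW.
have [t0 _] := exists_neq T_ge2.
set S := [set y | _]%classic.
have Sub n j u : ((f n j u)%:E <= ereal_sup S)%E.
  by apply: ereal_sup_ubound; exists n, j, u.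
have F_ge0 : (0 <= ereal_sup S)%E.
  apply: le_trans (Sub 0%N (j0 U r T) t0); rewrite lee_fin.
  have hj0 : j0 U r T - sigma%:Z - 2 <= j0 U r T by clear; lia.
  exact: (family_ge0 gf _ _ hj0).
(* An infinite supremum makes the right-hand side infinite, the constant being positive; otherwise
   it serves as the real bound [F]. *)
case FE : (ereal_sup S) Sub F_ge0 => [F| |] //= Sub F_ge0; last first.
  by rewrite addye // gt0_muley ?leey // lte_fin.
have fF n j u : f n j u <= F by rewrite -lee_fin.
have [L L_lt L_split] := greedy_labels gf kappa_ge5 regU rhoP BsetM T_ell2 T_ge2.
apply: (le_trans (gammaT_le kappa_ge5 regU T_ell2 T_ge2 gf sigma2 t0 L_lt L_split fF)).
rewrite -EFinD -EFinM lee_fin; move: F_ge0; rewrite lee_fin => F_ge0.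
move: (r ^ _) X_ge0 => X X_ge0.
have -> : r * X + kappa%:R * 2 ^+ kappa *
    (2 * r * X + 4 * 2 ^+ kappa * r ^+ sigma.+1 * sigma.+2%:R * F) = C1 * X + C2 * F.
  by rewrite /C1 /C2; ring.
have C1F : 0 <= C1 * F by rewrite mulr_ge0 // ltW.
have C2X : 0 <= C2 * X by rewrite mulr_ge0.
nra.
Qed.
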